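(* Let $n\ge 3$ and let $a,b,r\ge 0$ be integers. Then $$\mathcal{H}_{a,b}\otimes \mathbb{S}^{\infty}_{(r)} \;=\; \bigoplus_{j=0}^{a}\ \bigoplus_{\substack{i=0\\ i+j\le r}}^{b}\ \mathcal{I}_{b-i,\,j}\,\mathcal{M}_{a-j,\,i}^{(b+r-(i+j))},$$ that is, the subspaces on the right-hand side are contained in $\mathcal{H}_{a,b}\otimes\mathbb{S}^\infty_{(r)}$ and $\mathcal{H}_{a,b}\otimes\mathbb{S}^\infty_{(r)}$ is their direct sum; here each $\mathcal{M}_{c,d}^{(s)}$ is the space of symplectic $h$-monogenics of bi-degree $(c,d)$ with values in $\mathbb{S}^\infty_{(s)}$.
   Context: Coordinates on $\mathbb{R}^{2n}\cong\mathbb{C}^n$ are $(x_1,\dots,x_n,y_1,\dots,y_n)$, $z_j=x_j+iy_j$, $\partial_{z_j}=\frac12(\partial_{x_j}-i\partial_{y_j})$, $\partial_{\bar z_j}=\frac12(\partial_{x_j}+i\partial_{y_j})$. $\mathcal{P}_{a,b}$ is the space of complex polynomials $P(z,\bar z)$ on $\mathbb{R}^{2n}$ of bi-degree $(a,b)$, i.e. $P(\lambda z,\bar\lambda\bar z)=\lambda^a\bar\lambda^bP(z,\bar z)$. $\Delta=\sum_j(\partial_{x_j}^2+\partial_{y_j}^2)$ and $\mathcal{H}_{a,b}=\mathcal{P}_{a,b}\cap\ker\Delta$. The symplectic spinor space $\mathbb{S}^\infty$ is the Schwartz space $\mathcal{S}(\mathbb{R}^n,\mathbb{C})$ in variables $q=(q_1,\dots,q_n)$.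 $\mathbb{S}^\infty_{(r)}\subset\mathbb{S}^\infty$ is the $r$-th eigenspace of the Hermite operator $\sum_j(\partial_{q_j}^2-q_j^2)$ (eigenvalue $-(2r+n)$), i.e. the span of the functions $e^{-|q|^2/2}\prod_j \mathsf{H}_{k_j}(q_j)$ with $k_1+\dots+k_n=r$, where $\mathsf{H}_k$ are the Hermite polynomials ($\mathsf H_r(t)=2t\mathsf H_{r-1}(t)-2(r-1)\mathsf H_{r-2}(t)$). On $\mathcal{P}(\mathbb{R}^{2n},\mathbb{C})\otimes\mathbb{S}^\infty$ define $D_s=\sum_j(iq_j\partial_{y_j}-\partial_{q_j}\partial_{x_j})$ and $D_t=\sum_j(iq_j\partial_{x_j}+\partial_{y_j}\partial_{q_j})$. With $L_j=q_j+\partial_{q_j}$, $R_j=q_j-\partial_{q_j}$ put $D_z=\frac12(D_s+iD_t)=-\sum_jL_j\partial_{z_j}$, $D_z^\dagger=\frac12(D_s-iD_t)=\sum_jR_j\partial_{\bar z_j}$, $X_z=\frac i2\sum_jL_j\bar z_j$, $X_z^\dagger=\frac i2\sum_jR_jz_j$. A function is a symplectic $h$-monogenic if it lies in $\ker D_s\cap\ker D_t$. For integers $c,d,s\ge0$ with $d\le s$, $$\mathcal{M}_{c,d}^{(s)}=\big(\mathcal{P}_{c,d}\otimes\mathbb{S}^\infty_{(s)}\big)\cap\ker D_s\cap\ker D_t .$$ Let $\mathbb{E}=\sum_j(x_j\partial_{x_j}+y_j\partial_{y_j})$ and $|z|^2=\sum_j|z_j|^2$. The operators $$\mathbb{X}_z=(\mathbb{E}+n-2)X_z+\tfrac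 i2|z|^2D_z,\qquad \mathbb{X}_z^\dagger=(\mathbb{E}+n-2)X_z^\dagger-\tfrac i2|z|^2D_z^\dagger$$ map $\ker\Delta$ to $\ker\Delta$, and for $k,\ell\in\mathbb{N}$ one sets $\mathcal{I}_{k,\ell}=\mathbb{X}_z^k(\mathbb{X}_z^\dagger)^\ell\in\mathrm{End}(\ker\Delta)$, with $\mathcal{I}_{0,0}=\mathrm{Id}$. *)

(* Defs.v *)
From mathcomp Require Import all_boot all_order all_algebra.
From mathcomp Require Import all_classical all_reals all_analysis.
From mathcomp Require Import complex.
(* [mpoly] is not imported: its notations clash with those of the analysis library. *)
From mathcomp Require mpoly.

Set Implicit Arguments.
Unset Strict Implicit.
Unset Printing Implicit Defensive.

Import Order.TTheory GRing.Theory Num.Theory.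
Import numFieldNormedType.Exports.

Local Open Scope classical_set_scope.
Local Open Scope complex_scope.
Local Open Scope ring_scope.

(* Points of R^{2n} are pairs (x, y); an element of P(R^{2n}, C) (x) S^oo is
   identified with the C-valued function of ((x, y), q) it induces. *)
Notation zspace R n := ('rV[R]_n * 'rV[R]_n)%type.
Notation zqspace R n := ('rV[R]_n * 'rV[R]_n * 'rV[R]_n)%type.

Section Span.
Context {R : realType} {T : Type}.

Notation C := R[i].

Definition lin_span (A : set (T -> C)) : set (T -> C) :=
  [set f | exists (m : nat) (c : 'I_m -> C) (g : 'I_m -> T -> C),
     (forall k, A (g k)) /\ f = (fun t => \sum_(k < m) c k * g k t)].

Definition internal_direct_sum {I : finType} (P : pred I)
    (W : I -> set (T -> C)) (V : set (T -> C)) : Prop :=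
  [/\ forall i, P i -> W i `<=` V,
      forall f, V f -> exists g : I -> T -> C,
        (forall i, P i -> W i (g i)) /\ f = \sum_(i | P i) g i
    & forall g : I -> T -> C, (forall i, P i -> W i (g i)) ->
        \sum_(i | P i) g i = 0 -> forall i, P i -> g i = 0].

End Span.

Section DerivativeC.
Context {R : realType} {V : normedModType R}.

(* Real directional derivative of a complex-valued function. *)
Definition deriveC (v : V) (f : V -> R[i]) : V -> R[i] := fun p =>
  'D_v (fun u => complex.Re (f u)) p +i* 'D_v (fun u => complex.Im (f u)) p.

End DerivativeC.

Section Polynomials.
Context {R : realType} {n : nat}.

Notation C := R[i].
Implicit Types (p : zspace R n -> C) (w : zspace R n).

Definition zcoord w (j : 'I_n) : C := w.1 0 j +i* w.2 0 j.

(* The arguments (u, v) of a polynomial in the 2n variables (z, \bar z). *)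
Definition zzbar (u v : 'rV[C]_n) : 'I_(n + n) -> C := fun k => row_mx u v 0 k.

Definition bihomogeneous (a b : nat) (P : mpoly.mpoly (n + n) C) : Prop :=
  forall (lam : C) (z : 'rV[C]_n),
    mpoly.meval (zzbar (lam *: z) (conjc lam *: map_mx conjc z)) P =
    lam ^+ a * conjc lam ^+ b * mpoly.meval (zzbar z (map_mx conjc z)) P.

Definition polys (a b : nat) : set (zspace R n -> C) :=
  [set p | exists2 P : mpoly.mpoly (n + n) C, bihomogeneous a b P &
     p = (fun w => let z := \row_j zcoord w j in
                   mpoly.meval (zzbar z (map_mx conjc z)) P)].

Definition laplacian p : zspace R n -> C := \sum_(j < n)
  (deriveC (delta_mx 0 j, 0) (deriveC (delta_mx 0 j, 0) p) +
   deriveC (0, delta_mx 0 j) (deriveC (0, delta_mx 0 j) p)).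

Definition harmonics (a b : nat) : set (zspace R n -> C) :=
  polys a b `&` [set p | laplacian p = 0].

End Polynomials.

Section Spinors.
Context {R : realType}.

(* The physicists' Hermite polynomials. *)
Fixpoint hermite (k : nat) : {poly R} :=
  if k is k1.+1 then
    if k1 is k2.+1 then
      2%:R *: 'X * hermite k1 - (2 * k1)%:R *: hermite k2
    else 2%:R *: 'X
  else 1.

Context {n : nat}.

Definition hermite_function (k : 'I_n -> nat) : 'rV[R]_n -> R[i] := fun q =>
  (expR (- (\sum_(j < n) q 0 j ^+ 2) / 2) *
   \prod_(j < n) (hermite (k j)).[q 0 j])%:C.

(* The Hermite functions are Schwartz functions and span the eigenspaces of the
   Hermite operator; the Schwartz space only serves as an ambient space, so it
   is not introduced separately. *)
Definition spinors (r : nat) : set ('rV[R]_n -> R[i]) :=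
  lin_span [set phi | exists2 k : 'I_n -> nat,
    (\sum_(j < n) k j)%N = r & phi = hermite_function k].

(* U (x) V inside the functions on R^{2n} x R^n *)
Definition tensor (U : set (zspace R n -> R[i])) (V : set ('rV[R]_n -> R[i])) :
    set (zqspace R n -> R[i]) :=
  lin_span [set F | exists p phi,
    [/\ U p, V phi & F = (fun w => p w.1 * phi w.2)]].

End Spinors.

Section Operators.
Context {R : realType} {n : nat}.

Notation C := R[i].
Implicit Types (F : zqspace R n -> C) (j : 'I_n).

Definition dx j F := deriveC ((delta_mx 0 j, 0), 0) F.
Definition dy j F := deriveC ((0, delta_mx 0 j), 0) F.
Definition dq j F := deriveC ((0, 0), delta_mx 0 j) F.

Definition mulx j F : zqspace R n -> C := fun w => (w.1.1 0 j)%:C * F w.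
Definition muly j F : zqspace R n -> C := fun w => (w.1.2 0 j)%:C * F w.
Definition mulq j F : zqspace R n -> C := fun w => (w.2 0 j)%:C * F w.
Definition mulz j F : zqspace R n -> C := fun w => zcoord w.1 j * F w.
Definition mulzbar j F : zqspace R n -> C := fun w => conjc (zcoord w.1 j) * F w.
Definition mulnormz2 F : zqspace R n -> C := fun w =>
  (\sum_(j < n) `|zcoord w.1 j| ^+ 2) * F w.
Definition scale (c : C) F : zqspace R n -> C := fun w => c * F w.

Definition Ds F := \sum_(j < n) (scale 'i%C (mulq j (dy j F)) - dq j (dx j F)).
Definition Dt F := \sum_(j < n) (scale 'i%C (mulq j (dx j F)) + dy j (dq j F)).

Definition Lop j F := mulq j F + dq j F.
Definition Rop j F := mulq j F - dq j F.

Definition Dz F := scale (1 / 2) (Ds F + scale 'i%C (Dt F)).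
Definition Dzd F := scale (1 / 2) (Ds F - scale 'i%C (Dt F)).
Definition Xz F := scale ('i%C / 2) (\sum_(j < n) Lop j (mulzbar j F)).
Definition Xzd F := scale ('i%C / 2) (\sum_(j < n) Rop j (mulz j F)).

Definition euler F := \sum_(j < n) (mulx j (dx j F) + muly j (dy j F)).

Definition XXz F :=
  euler (Xz F) + scale (n%:R - 2) (Xz F) + scale ('i%C / 2) (mulnormz2 (Dz F)).
Definition XXzd F :=
  euler (Xzd F) + scale (n%:R - 2) (Xzd F) - scale ('i%C / 2) (mulnormz2 (Dzd F)).

(* The operator I_{k,l}, total on functions; it is meant on ker Delta. *)
Definition embed (k l : nat) F := iter k XXz (iter l XXzd F).

Definition h_monogenics (c d s : nat) : set (zqspace R n -> C) :=
  tensor (polys c d) (spinors s) `&` [set F | Ds F = 0 /\ Dt F = 0].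

End Operators.

(* Main.v *)
Require Import Defs.
From mathcomp Require Import all_boot all_order all_algebra.
From mathcomp Require Import all_classical all_reals all_analysis.
From HB Require Import structures.
From mathcomp Require Import complex.
From mathcomp Require Import ring lra zify.
From mathcomp Require mpoly.
Import (canonicals, coercions) mpoly.

Set Implicit Arguments.
Unset Strict Implicit.
Unset Printing Implicit Defensive.

Import Order.TTheory GRing.Theory Num.Theory.
Import numFieldNormedType.Exports.

Local Open Scope classical_set_scope.
Local Open Scope complex_scope.
Local Open Scope ring_scope.

(** Expanding spinors in Hermite functions turns a spinor-valued polynomial into
    an ordinary polynomial: z^a, conj(z)^b and the Hermite function of index g
    become the monomial z^a w^b u^g. The operators [Rop j] and [Lop j] become u_j
    and 2 d/du_j, so that, up to scalars, [Dz], [Dzd], [Xz] and [Xzd] become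

      A = sum_j d/du_j d/dz_j,   B  = sum_j u_j d/dw_j,
      Bs = sum_j w_j d/du_j,     As = sum_j u_j z_j.

    With D = sum_j d/dz_j d/dw_j (a quarter of the Laplacian), N = sum_j z_j w_j
    and the three degree operators, they span a copy of gl(3), the Howe dual of
    GL(n). A monogenic is a joint kernel vector of A and B; as [A, B] = D, it is
    harmonic.

    On ker D the operators A and B commute, and so do the operators Y and T
    ([raiseW] and [raiseZ], scalar multiples of [XXz] and [XXzd]); moreover A
    commutes with Y and B with T ([A_raiseW], [B_raiseZ], [raiseWZ_comm]). This
    makes everything explicit: for m monogenic of tri-degree (c, d, s), with
    q = c + d + n - 1,

      B (Y^k T^l m) = (q + k - 1) k (s - d - k + 1) Y^(k-1) T^l m,
      A (Y^k T^l m) = (q + l - 1) l (s + c + n + l - 1) Y^k T^(l-1) m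

    ([B_embedding], [A_embedding]). All three parts of the theorem follow from
    these formulas.

    Spanning ([harmonic_decomposition]). By induction on the degree in z, A F is
    a sum of vectors Y^k T^l m. The second coefficient never vanishes, so dividing
    by it gives a sum G of such vectors with A G = A F, and F - G lies in ker A.
    There the same argument is run with B and the degree in w
    ([kerA_decomposition]). The first coefficient vanishes for k = s - d + 1, but
    the term of B F that this leaves unmatched is zero: B and Bs generate an sl(2)
    acting locally finitely, for which B^p is injective on the vectors of weight
    at most -p ([iterB_eq0]).

    The same vanishing coefficient, with the case p = 1 of that injectivity, gives
    Y^k m = 0 for k > s - d ([iterW_eq0]); in the indices of the theorem this is
    the condition i + j <= r.

    Independence ([embedding_independent]). In a vanishing sum, take a nonzero
    term Y^k T^l m with k + l maximal; B^k A^l kills all the other terms and sends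
    this one to a nonzero multiple of m.

    What remains is the dictionary between functions and polynomials. [realize]
    sends a polynomial to the function it represents. It intertwines the operators
    ([Ds_realize], [Dt_realize], [embed_realize]), and it is injective because a
    nonzero polynomial can be differentiated down to a nonzero constant
    ([realize_inj]). The spaces of the theorem are the images of the joint
    eigenspaces of the degree operators ([tensor_harmonics_in_realize],
    [tensor_harmonics_realize], [monogenic_in_realize], [monogenic_realize]). *)

(** * Equality of linear combinations *)

(** Syntax for linear combinations of numbered vectors: [ring] does not apply to
    vectors, but two such expressions are equal as soon as their coefficients are,
    and those are scalars. *)
Inductive lincomb (K : Type) :=
  LCAtom of nat | LC0 | LCAdd of lincomb K & lincomb K
| LCOpp of lincomb K | LCScale of K & lincomb K.
Arguments LC0 {K}.
Arguments LCAtom {K} _.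

Section LinearCombinations.
Context {K : comPzRingType} {V : lmodType K}.

Fixpoint lc_eval (vs : seq V) (e : lincomb K) : V :=
  match e with
  | LCAtom i => vs`_i
  | LC0 => 0
  | LCAdd e1 e2 => lc_eval vs e1 + lc_eval vs e2
  | LCOpp e1 => - lc_eval vs e1
  | LCScale c e1 => c *: lc_eval vs e1
  end.

Fixpoint lc_coef (e : lincomb K) (i : nat) : K :=
  match e with
  | LCAtom j => (i == j)%:R
  | LC0 => 0
  | LCAdd e1 e2 => lc_coef e1 i + lc_coef e2 i
  | LCOpp e1 => - lc_coef e1 i
  | LCScale c e1 => c * lc_coef e1 i
  end.

Lemma lc_evalE vs e :
  lc_eval vs e = \sum_(i < size vs) lc_coef e i *: vs`_i.
Proof.
elim: e => [j||e1 IH1 e2 IH2|e1 IH1|c e1 IH1] /=; rewrite ?IH1 ?IH2.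
- have [jlt|jge] := ltnP j (size vs).
    rewrite (bigD1 (Ordinal jlt)) //= eqxx scale1r big1 ?addr0 // => i ne.
    by rewrite -(inj_eq val_inj) /= in ne; rewrite (negPf ne) scale0r.
  rewrite nth_default // big1 // => i _.
  by rewrite ltn_eqF ?scale0r // (leq_trans (ltn_ord i)).
- by rewrite big1 // => i _; rewrite scale0r.
- by rewrite -big_split; apply: eq_bigr => i _; rewrite scalerDl.
- by rewrite -sumrN; apply: eq_bigr => i _; rewrite scaleNr.
- by rewrite scaler_sumr; apply: eq_bigr => i _; rewrite scalerA.
Qed.

Lemma lc_eval_eq vs e1 e2 :
    foldr (fun i P => lc_coef e1 i = lc_coef e2 i /\ P) True (iota 0 (size vs)) ->
  lc_eval vs e1 = lc_eval vs e2.
Proof.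
move=> h; rewrite !lc_evalE; apply: eq_bigr => i _; congr (_ *: _).
have : nat_of_ord i \in iota 0 (size vs) by rewrite mem_iota ltn_ord.
elim: (iota 0 (size vs)) h => //= j s IHs [hj hs].
by rewrite inE => /orP[/eqP->|/IHs]; [|apply].
Qed.

End LinearCombinations.

Ltac lc_index v vs :=
  lazymatch vs with
  | v :: _ => constr:(0%N)
  | _ :: ?vs' => let i := lc_index v vs' in constr:(i.+1)
  end.

Ltac lc_reify K vs e :=
  lazymatch e with
  | GRing.zero => constr:(@LC0 K)
  | ?a + ?b => let x := lc_reify K vs a in
      let y := lc_reify K vs b in constr:(@LCAdd K x y)
  | - ?a => let x := lc_reify K vs a in constr:(@LCOpp K x)
  | ?c *: ?a => let x := lc_reify K vs a in constr:(@LCScale K c x)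
  | _ => let i := lc_index e vs in constr:(@LCAtom K i)
  end.

(** The vectors [vs] are taken as atoms, whatever their inner structure; one goal
    per atom is left, about its coefficients on both sides. *)
Ltac linear_combination K vs :=
  lazymatch goal with |- ?l = ?r =>
    let x := lc_reify K vs l in let y := lc_reify K vs r in
    refine (@lc_eval_eq _ _ vs x y _); rewrite /=; repeat split
  end.

(** * Three dual pairs of generators of the Weyl algebra *)

(** The variables come in three families of [n]: the coordinates z, their
    conjugates w, and variables u that stand for the creation operators on spinors. *)
Inductive kind := KZ | KW | KU.

Definition same_kind (v v' : kind) : bool :=
  match v, v' with KZ, KZ | KW, KW | KU, KU => true | _, _ => false end.

Inductive generator := Mul of kind | Der of kind.

Section Quadratic.
Context {K : numFieldType} {V : lmodType K} {n : nat}.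
Variable act : generator -> 'I_n -> {linear V -> V}.

Definition kappa (x y : generator) : K :=
  match x, y with
  | Der v, Mul v' => if same_kind v v' then 1 else 0
  | Mul v, Der v' => if same_kind v v' then -1 else 0
  | _, _ => 0
  end.

Hypothesis ccr : forall x y j k F,
  act x j (act y k F) = act y k (act x j F) + ((j == k)%:R * kappa x y) *: F.

Definition quad x y (F : V) : V := \sum_j act x j (act y j F).

Lemma quadD x y : {morph quad x y : F G / F + G}.
Proof.
by move=> F G; rewrite -big_split; apply: eq_bigr => j _ /=; rewrite !raddfD.
Qed.

Lemma quadZ x y c F : quad x y (c *: F) = c *: quad x y F.
Proof.
by rewrite scaler_sumr; apply: eq_bigr => j _; rewrite !linearZ.
Qed.

Lemma quadN x y : {morph quad x y : F / - F}.
Proof. by move=> F; rewrite -scaleN1r quadZ scaleN1r. Qed.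

Lemma quad0 x y : quad x y 0 = 0.
Proof. by apply: big1 => j _; rewrite !raddf0. Qed.

Lemma quad_sum x y (I : Type) (s : seq I) (P : pred I) (F : I -> V) :
  quad x y (\sum_(i <- s | P i) F i) = \sum_(i <- s | P i) quad x y (F i).
Proof. exact: (big_morph _ (quadD x y) (quad0 x y)). Qed.

Definition quadE := (quadD, quadN, quadZ, quad0).

Lemma sum_delta (j : 'I_n) (c : K) (G : 'I_n -> V) :
  \sum_k ((j == k)%:R * c) *: G k = c *: G j.
Proof.
rewrite (bigD1 j) //= eqxx mul1r big1 ?addr0 // => k.
by rewrite eq_sym => /negPf->; rewrite mul0r scale0r.
Qed.

(** Commuting past a product of two generators is a derivation, and each of the
    two factors leaves one term because the commutators are scalar. *)
Lemma act_quad y x' y' j F :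
  act y j (quad x' y' F) =
  quad x' y' (act y j F) + kappa y x' *: act y' j F + kappa y y' *: act x' j F.
Proof.
rewrite raddf_sum /= -addrA.
rewrite -(sum_delta j _ (fun k => act y' k F)).
rewrite -(sum_delta j _ (fun k => act x' k F)) -!big_split /=.
apply: eq_bigr => k _; rewrite ccr (ccr y y') linearD linearZ /=.
by rewrite -addrA [X in _ + X]addrC.
Qed.

(** The quadratic elements of the Weyl algebra are closed under brackets; each of
    the brackets computed below is an instance of this formula. *)
Lemma quad_comm x y x' y' F :
  quad x y (quad x' y' F) = quad x' y' (quad x y F)
    + kappa y x' *: quad x y' F + kappa y y' *: quad x x' F
    + kappa x x' *: quad y' y F + kappa x y' *: quad x' y F.
Proof.
have -> : quad x' y' (quad x y F) = \sum_j quad x' y' (act x j (act y j F)).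
  by rewrite exchange_big; apply: eq_bigr => k _; rewrite !raddf_sum.
rewrite !scaler_sumr -!big_split; apply: eq_bigr => j _ /=.
rewrite act_quad !linearD !linearZ /= act_quad.
set a := quad _ _ _; set b := act x j (act y' j F); set c := act x j _.
set d := act y' j _; set e := act x' j _.
linear_combination K [:: a; b; c; d; e]; ring.
Qed.

Lemma quadC x y F : quad x y F = quad y x F + (n%:R * kappa x y) *: F.
Proof.
have -> : (n%:R * kappa x y) *: F = \sum_(j < n) kappa x y *: F.
  by rewrite sumr_const card_ord scalerMnl mulr_natl.
rewrite -big_split; apply: eq_bigr => j _.
by rewrite ccr eqxx mul1r.
Qed.

(* [A] and [B] are the two Dirac operators, [D] the Laplacian, [N] the squared norm
   of z, up to scalars; [As] and [Bs] are the Fischer adjoints of [A] and [B]. *)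
Notation A := (quad (Der KU) (Der KZ)).
Notation B := (quad (Mul KU) (Der KW)).
Notation D := (quad (Der KZ) (Der KW)).
Notation As := (quad (Mul KU) (Mul KZ)).
Notation Bs := (quad (Mul KW) (Der KU)).
Notation N := (quad (Mul KZ) (Mul KW)).
Notation number v := (quad (Mul v) (Der v)).

Ltac bracket :=
  let F := fresh "F" in
  move=> F; rewrite quad_comm /kappa /= !scale0r ?scale1r ?scaleN1r;
  rewrite ?addr0.

Lemma A_B F : A (B F) = B (A F) + D F.
Proof. by move: F; bracket; rewrite (quadC (Der KW)) /= mulr0 scale0r addr0. Qed.

Lemma A_D F : A (D F) = D (A F).
Proof. by move: F; bracket. Qed.

Lemma B_D F : B (D F) = D (B F).
Proof. by move: F; bracket. Qed.

Lemma A_As F : A (As F) = As (A F) + number KU F + number KZ F + n%:R *: F.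
Proof.
move: F; bracket; rewrite (quadC (Der KU) (Mul KU)) /= mulr1.
set a := As _; set b := number KU _; set c := number KZ _.
linear_combination K [:: a; b; c; F]; ring.
Qed.

Lemma B_Bs F : B (Bs F) = Bs (B F) + number KU F - number KW F.
Proof. by move: F; bracket. Qed.

Lemma A_Bs F : A (Bs F) = Bs (A F).
Proof. by move: F; bracket. Qed.

Lemma B_As F : B (As F) = As (B F).
Proof. by move: F; bracket. Qed.

Lemma D_As F : D (As F) = As (D F) + B F.
Proof. by move: F; bracket. Qed.

Lemma D_Bs F : D (Bs F) = Bs (D F) + A F.
Proof.
move: F; bracket; rewrite (quadC (Der KZ) (Der KU)) /=.
by rewrite mulr0 scale0r addr0.
Qed.

Lemma A_N F : A (N F) = N (A F) + Bs F.
Proof.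
move: F; bracket; rewrite (quadC (Der KU) (Mul KW)) /=.
by rewrite mulr0 scale0r addr0.
Qed.

Lemma B_N F : B (N F) = N (B F) + As F.
Proof. by move: F; bracket. Qed.

Lemma D_N F :
  D (N F) = N (D F) + number KZ F + number KW F + n%:R *: F.
Proof.
move: F; bracket; rewrite (quadC (Der KZ) (Mul KZ)) /= mulr1.
set a := N _; set b := number KZ _; set c := number KW _.
linear_combination K [:: a; b; c; F]; ring.
Qed.

Lemma Bs_As F : Bs (As F) = As (Bs F) + N F.
Proof.
move: F; bracket; rewrite (quadC (Mul KW) (Mul KZ)) /=.
by rewrite mulr0 scale0r addr0.
Qed.

Lemma N_As F : N (As F) = As (N F).
Proof. by move: F; bracket. Qed.

Lemma N_Bs F : N (Bs F) = Bs (N F).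
Proof. by move: F; bracket. Qed.


(** In a polynomial representation the eigenvalues of the degree operators are
    natural numbers; this is what makes lowering operators locally nilpotent. *)
Hypothesis number_nat : forall v t F,
  number v F = t *: F -> F != 0 -> exists k : nat, t = k%:R.

(** Weights are scalars rather than natural numbers, so that lowering a degree
    never truncates; a vector with a negative weight is then zero. *)
Definition weight (a b r : K) (F : V) : Prop :=
  [/\ number KZ F = a *: F, number KW F = b *: F & number KU F = r *: F].

Lemma weight_eq a b r a' b' r' F :
  a = a' -> b = b' -> r = r' -> weight a b r F -> weight a' b' r' F.
Proof. by move=> <- <- <-. Qed.

Lemma weight0 a b r : weight a b r 0.
Proof. by split; rewrite quad0 scaler0. Qed.

Lemma weightD a b r F G :
  weight a b r F -> weight a b r G -> weight a b r (F + G).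
Proof.
by move=> [F1 F2 F3] [G1 G2 G3]; split; rewrite quadD scalerDr ?F1 ?F2 ?F3
  ?G1 ?G2 ?G3.
Qed.

Lemma weightZ a b r c F : weight a b r F -> weight a b r (c *: F).
Proof.
by move=> [F1 F2 F3]; split; rewrite quadZ ?F1 ?F2 ?F3 !scalerA mulrC.
Qed.

Lemma weight_sum a b r (I : Type) (s : seq I) (P : pred I) (F : I -> V) :
  (forall i, P i -> weight a b r (F i)) -> weight a b r (\sum_(i <- s | P i) F i).
Proof.
by move=> h; apply: big_ind => //; [apply: weight0|apply: weightD].
Qed.

Definition degree_shift (x : generator) v : K :=
  match x with
  | Mul v' => if same_kind v v' then 1 else 0
  | Der v' => if same_kind v v' then -1 else 0
  end.

Lemma number_act v x j F :
  number v (act x j F) = act x j (number v F) + degree_shift x v *: act x j F.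
Proof.
rewrite act_quad; set G := number v _.
case: x @G => [] x; case: v; case: x => G; rewrite /kappa /degree_shift /=;
  linear_combination K [:: G; act (Mul KZ) j F; act (Mul KW) j F;
    act (Mul KU) j F; act (Der KZ) j F; act (Der KW) j F; act (Der KU) j F];
  ring.
Qed.

Lemma number_quad v x y F :
  number v (quad x y F) =
  quad x y (number v F) + (degree_shift x v + degree_shift y v) *: quad x y F.
Proof.
transitivity (\sum_j number v (act x j (act y j F))).
  by rewrite -quad_sum.
transitivity (\sum_j (act x j (act y j (number v F))
    + (degree_shift x v + degree_shift y v) *: act x j (act y j F))).
  apply: eq_bigr => j _; rewrite !number_act linearD linearZ /=.
  set a := act x j _; set b := act x j _.
  linear_combination K [:: a; b]; ring.
by rewrite big_split /= scaler_sumr.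
Qed.

Lemma weight_act x j a b r F : weight a b r F ->
  weight (a + degree_shift x KZ) (b + degree_shift x KW) (r + degree_shift x KU)
    (act x j F).
Proof.
by move=> [F1 F2 F3]; split; rewrite number_act ?F1 ?F2 ?F3 linearZ -scalerDl.
Qed.

Lemma weight_quad x y a b r F : weight a b r F ->
  weight (a + (degree_shift x KZ + degree_shift y KZ))
    (b + (degree_shift x KW + degree_shift y KW))
    (r + (degree_shift x KU + degree_shift y KU)) (quad x y F).
Proof.
by move=> [F1 F2 F3]; split; rewrite number_quad ?F1 ?F2 ?F3 quadZ -scalerDl.
Qed.

Lemma weight_A a b r F : weight a b r F -> weight (a - 1) b (r - 1) (A F).
Proof. by move/(weight_quad (Der KU) (Der KZ)) => /=; apply: weight_eq; ring. Qed.

Lemma weight_B a b r F : weight a b r F -> weight a (b - 1) (r + 1) (B F).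
Proof. by move/(weight_quad (Mul KU) (Der KW)) => /=; apply: weight_eq; ring. Qed.

Lemma weight_D a b r F : weight a b r F -> weight (a - 1) (b - 1) r (D F).
Proof. by move/(weight_quad (Der KZ) (Der KW)) => /=; apply: weight_eq; ring. Qed.

Lemma weight_As a b r F : weight a b r F -> weight (a + 1) b (r + 1) (As F).
Proof. by move/(weight_quad (Mul KU) (Mul KZ)) => /=; apply: weight_eq; ring. Qed.

Lemma weight_Bs a b r F : weight a b r F -> weight a (b + 1) (r - 1) (Bs F).
Proof. by move/(weight_quad (Mul KW) (Der KU)) => /=; apply: weight_eq; ring. Qed.

Lemma weight_N a b r F : weight a b r F -> weight (a + 1) (b + 1) r (N F).
Proof. by move/(weight_quad (Mul KZ) (Mul KW)) => /=; apply: weight_eq; ring. Qed.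

(** ** The harmonic raising operators *)

(** The products [Bs F] and [As F] are not harmonic for harmonic [F]. These
    operators are their harmonic projections, multiplied by the degree factor that
    would otherwise stand in the denominator. *)
Definition raiseW F :=
  number KZ (Bs F) + number KW (Bs F) + (n%:R - 2) *: Bs F - N (A F).
Definition raiseZ F :=
  number KZ (As F) + number KW (As F) + (n%:R - 2) *: As F - N (B F).
Notation Y := raiseW.
Notation T := raiseZ.

Lemma raiseWZ c F : Y (c *: F) = c *: Y F.
Proof.
rewrite /Y !quadZ.
linear_combination K
  [:: number KZ (Bs F); number KW (Bs F); Bs F; N (A F)]; ring.
Qed.

Lemma raiseZZ c F : T (c *: F) = c *: T F.
Proof.
rewrite /T !quadZ.
linear_combination K
  [:: number KZ (As F); number KW (As F); As F; N (B F)]; ring.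
Qed.

Lemma raiseW_weight a b r F : weight a b r F ->
  Y F = (a + b + n%:R - 1) *: Bs F - N (A F).
Proof.
move=> /weight_Bs[hZ hW _]; rewrite /Y hZ hW.
set x := Bs F; set y := N _.
by linear_combination K [:: x; y]; ring.
Qed.

Lemma raiseZ_weight a b r F : weight a b r F ->
  T F = (a + b + n%:R - 1) *: As F - N (B F).
Proof.
move=> /weight_As[hZ hW _]; rewrite /T hZ hW.
set x := As F; set y := N _.
by linear_combination K [:: x; y]; ring.
Qed.

Definition harmonic_weight a b r F := weight a b r F /\ D F = 0.
Notation HW := harmonic_weight.

Lemma harmonic_A a b r F : HW a b r F -> HW (a - 1) b (r - 1) (A F).
Proof.
by move=> [wF hF]; split; [apply: weight_A|rewrite -A_D hF quad0].
Qed.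

Lemma harmonic_B a b r F : HW a b r F -> HW a (b - 1) (r + 1) (B F).
Proof.
by move=> [wF hF]; split; [apply: weight_B|rewrite -B_D hF quad0].
Qed.

(** [D (Bs F)] is [A F], and [D (N (A F))] is [A F] times the total degree of
    [A F] plus [n]; the degree factor in [raiseW] makes the two cancel. *)
Lemma harmonic_raiseW a b r F : HW a b r F -> HW a (b + 1) (r - 1) (Y F).
Proof.
move=> [wF hF]; rewrite (raiseW_weight wF); split.
  apply: weightD; first by apply/weightZ/weight_Bs.
  rewrite -scaleN1r; apply: weightZ.
  by apply: weight_eq (weight_N (weight_A wF)); ring.
have [hZ hW _] := weight_A wF.
rewrite !quadE D_Bs D_N -A_D hF hZ hW !quad0; set x := A F.
by linear_combination K [:: x]; ring.
Qed.

Lemma harmonic_raiseZ a b r F : HW a b r F -> HW (a + 1) b (r + 1) (T F).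
Proof.
move=> [wF hF]; rewrite (raiseZ_weight wF); split.
  apply: weightD; first by apply/weightZ/weight_As.
  rewrite -scaleN1r; apply: weightZ.
  by apply: weight_eq (weight_N (weight_B wF)); ring.
have [hZ hW _] := weight_B wF.
rewrite !quadE D_As D_N -B_D hF hZ hW !quad0; set x := B F.
by linear_combination K [:: x]; ring.
Qed.

(** Passing [A] through [N] produces one extra [Bs]. As [A] lowers the total degree
    by one, this is the difference of the degree factors of the two sides. *)
Lemma A_raiseW a b r F : HW a b r F -> A (Y F) = Y (A F).
Proof.
move=> [wF hF]; rewrite (raiseW_weight wF) (raiseW_weight (weight_A wF)).
rewrite !quadE A_Bs A_N.
set x := Bs _; set y := N _.
by linear_combination K [:: x; y]; ring.
Qed.

Lemma B_raiseZ a b r F : HW a b r F -> B (T F) = T (B F).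
Proof.
move=> [wF hF]; rewrite (raiseZ_weight wF) (raiseZ_weight (weight_B wF)).
rewrite !quadE B_As B_N.
set x := As _; set y := N _.
by linear_combination K [:: x; y]; ring.
Qed.

(** Both sides expand over the same five normally ordered words; their
    coefficients of [N F] agree because the brackets of [A] with [As] and of [B]
    with [Bs] contribute [r + a + n] and [r - b]. *)
Lemma raiseWZ_comm a b r F : HW a b r F -> Y (T F) = T (Y F).
Proof.
move=> hF; have [wF DF] := hF.
have [wT _] := harmonic_raiseZ hF; have [wY _] := harmonic_raiseW hF.
have [fZ fW fU] := wF.
rewrite (raiseW_weight wT) (raiseZ_weight wY).
rewrite (raiseZ_weight wF) (raiseW_weight wF).
rewrite !quadE A_As B_Bs A_N B_N Bs_As fZ fW fU !quadE -N_As -N_Bs.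
rewrite A_B DF addr0.
set x1 := As (Bs F); set x2 := N F; set x3 := N (As _).
set x4 := N (Bs _); set x5 := N (N _).
by linear_combination K [:: x1; x2; x3; x4; x5]; ring.
Qed.

(** On the kernel of [B] the correction term of [raiseZ] vanishes, and only the
    bracket of [A] with [As] is left. *)
Lemma A_raiseZ a b r F : HW a b r F -> B F = 0 ->
  A (T F) = (a + b + n%:R - 1) *: (As (A F) + (r + a + n%:R) *: F).
Proof.
move=> [wF hF] BF; have [fZ fW fU] := wF.
rewrite (raiseZ_weight wF) BF quad0 subr0 quadZ A_As fZ fU.
set x := As _; by linear_combination K [:: x; F]; ring.
Qed.

Lemma B_raiseW a b r F : HW a b r F -> A F = 0 ->
  B (Y F) = (a + b + n%:R - 1) *: (Bs (B F) + (r - b) *: F).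
Proof.
move=> [wF hF] AF; have [fZ fW fU] := wF.
rewrite (raiseW_weight wF) AF quad0 subr0 quadZ B_Bs fW fU.
set x := Bs _; by linear_combination K [:: x; F]; ring.
Qed.

Lemma iter_morphD (f : V -> V) k :
  {morph f : F G / F + G} -> {morph iter k f : F G / F + G}.
Proof. by move=> fD F G; elim: k => //= k ->; rewrite fD. Qed.

Lemma iter_morphZ (f : V -> V) k :
    (forall c F, f (c *: F) = c *: f F) ->
  forall c F, iter k f (c *: F) = c *: iter k f F.
Proof. by move=> fZ c F; elim: k => //= k ->; rewrite fZ. Qed.

Lemma iter_morph0 (f : V -> V) k :
  (forall c F, f (c *: F) = c *: f F) -> iter k f 0 = 0.
Proof. by move=> fZ; rewrite -(scale0r (0 : V)) (iter_morphZ _ fZ) !scale0r. Qed.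

Lemma weight_natural a b r F : weight a b r F -> F != 0 ->
  exists i j k : nat, [/\ a = i%:R, b = j%:R & r = k%:R].
Proof.
move=> [fZ fW fU] F0.
have [i ->] := number_nat fZ F0; have [j ->] := number_nat fW F0.
by have [k ->] := number_nat fU F0; exists i, j, k.
Qed.

Lemma number_neg v k F : number v F = - k.+1%:R *: F -> F = 0.
Proof.
move=> hF; apply/eqP/negPn/negP => /(number_nat _)-/(_ v (- k.+1%:R)).
rewrite scaleNr -scaleNr => /(_ hF)[m] /eqP.
by rewrite eq_sym -addr_eq0 -natrD pnatr_eq0 addnS.
Qed.

(** ** The sl(2)-triple of [B] and [Bs] *)

(** Moving [Bs] to the left through [iter p B] collects an arithmetic progression of
    weights. *)
Lemma iterB_Bs_B a b r F p : weight a b r F ->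
  iter p B (Bs (B F)) =
  Bs (iter p.+1 B F) + (p%:R * (r - b + p%:R + 1)) *: iter p B F.
Proof.
move=> wF; have wp q : weight a (b - q%:R) (r + q%:R) (iter q B F).
  elim: q => [|q IHq] /=; first by rewrite subr0 addr0.
  by apply: weight_eq (weight_B IHq); rewrite // -natr1; ring.
elim: p => [|p IHp]; first by rewrite mul0r scale0r addr0.
rewrite iterS IHp quadD quadZ B_Bs; have [_ -> ->] := wp p.+1.
rewrite -[B (iter p B F)]/(iter p.+1 B F).
set x := Bs _; set y := iter p.+1 B F.
by linear_combination K [:: x; y]; rewrite -?natr1; ring.
Qed.

(** In a finite-dimensional representation of sl(2), the p-th power of the raising
    operator is injective on weights at most [- p]. Induction on [p] shows that [F]
    is an eigenvector of [Bs B] with eigenvalue at most zero. All the products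
    [B Bs] on the vectors [iter j Bs F] are then negative multiples of them, so that
    [iter j Bs F = 0] forces [F = 0]; and the degree in u of [iter j Bs F] is
    eventually negative. *)
Lemma iterB_eq0 a b r F p e : weight a b r F ->
  r - b = - (p + e)%:R -> iter p B F = 0 -> F = 0.
Proof.
elim: p e F => [//|p IHp] e F wF mu BpF.
have rE : r = b - (p.+1 + e)%:R by rewrite -mu; ring.
have BsB : Bs (B F) = - (p * e)%:R *: F.
  apply/eqP; rewrite -subr_eq0; apply/eqP.
  apply: (IHp e.+1); last first.
  - rewrite -scaleNr (iter_morphD _ (quadD _ _)) (iter_morphZ _ (quadZ _ _)).
    rewrite (iterB_Bs_B p wF) BpF quad0 add0r -scalerDl mu.
    rewrite (_ : _ + _ = 0) ?scale0r // natrD natrM -natr1; ring.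
  - by rewrite mu addSnnS.
  apply: weightD; last by rewrite -scaleNr; apply: weightZ.
  by apply: weight_eq (weight_Bs (weight_B wF)) => //; ring.
have ws j : weight a (b + j%:R) (r - j%:R) (iter j Bs F).
  elim: j => [|j IHj] /=; first by rewrite subr0 addr0.
  by apply: weight_eq (weight_Bs IHj); rewrite // -natr1; ring.
have chain j : B (iter j.+1 Bs F) =
    - (p * e + j.+1 * (p.+1 + e + j))%:R *: iter j Bs F.
  elim: j => [|j IHj].
    rewrite /= B_Bs BsB; have [_ -> ->] := wF.
    by linear_combination K [:: F]; rewrite rE; ring.
  rewrite iterS B_Bs IHj quadZ; have [_ -> ->] := ws j.+1.
  rewrite -iterS; set x := iter _ _ _.
  by linear_combination K [:: x]; rewrite rE; ring.
have down j : iter j Bs F = 0 -> F = 0.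
  elim: j => // j IHj h; apply: IHj.
  have /eqP := chain j; rewrite h quad0 eq_sym scaler_eq0 oppr_eq0 pnatr_eq0.
  by rewrite addn_eq0 mulnDr muln_eq0 /= => /orP[/andP[]//|/eqP].
have [->//|F0] := eqVneq F 0.
have [_ [_ [k [_ _ rk]]]] := weight_natural wF F0.
apply: (down k.+1); apply/eqP/negPn/negP => s0.
have [_ [_ [i [_ _]]]] := weight_natural (ws k.+1) s0.
rewrite rk => /eqP; rewrite subr_eq -natrD eqr_nat => /eqP.
lia.
Qed.

(** ** Lowering the images of monogenics *)

Lemma harmonic_iterW k a b r F :
  HW a b r F -> HW a (b + k%:R) (r - k%:R) (iter k Y F).
Proof.
move=> hF; elim: k => [|k /harmonic_raiseW[wk hk]]; first by rewrite addr0 subr0.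
by split=> //; apply: weight_eq wk; rewrite // -natr1; ring.
Qed.

Lemma harmonic_iterZ l a b r F :
  HW a b r F -> HW (a + l%:R) b (r + l%:R) (iter l T F).
Proof.
move=> hF; elim: l => [|l /harmonic_raiseZ[wl hl]]; first by rewrite !addr0.
by split=> //; apply: weight_eq wl; rewrite // -natr1; ring.
Qed.

Lemma A_iterW k a b r F : HW a b r F -> A (iter k Y F) = iter k Y (A F).
Proof.
by move=> hF; elim: k => //= k <-; rewrite (A_raiseW (harmonic_iterW k hF)).
Qed.

Lemma B_iterZ l a b r F : HW a b r F -> B (iter l T F) = iter l T (B F).
Proof.
by move=> hF; elim: l => //= l <-; rewrite (B_raiseZ (harmonic_iterZ l hF)).
Qed.

Lemma raiseW_iterZ l a b r F : HW a b r F -> Y (iter l T F) = iter l T (Y F).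
Proof.
by move=> hF; elim: l => //= l <-; rewrite (raiseWZ_comm (harmonic_iterZ l hF)).
Qed.

Lemma iterWZ_comm k l a b r F : HW a b r F ->
  iter k Y (iter l T F) = iter l T (iter k Y F).
Proof.
move=> hF; elim: k => //= k ->.
by rewrite (raiseW_iterZ l (harmonic_iterW k hF)).
Qed.

Definition monogenic a b r F := [/\ weight a b r F, A F = 0 & B F = 0].

Lemma monogenic0 a b r : monogenic a b r 0.
Proof. by split; rewrite ?quad0 //; apply: weight0. Qed.

Lemma monogenicZ a b r c F : monogenic a b r F -> monogenic a b r (c *: F).
Proof.
by move=> [wF AF BF]; split; rewrite ?quadZ ?AF ?BF ?scaler0 //; apply: weightZ.
Qed.

Lemma monogenic_harmonic a b r F : monogenic a b r F -> HW a b r F.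
Proof.
move=> [wF AF BF]; split=> //.
by have := A_B F; rewrite AF BF !quad0 add0r => <-.
Qed.

(** The coefficients of the two formulas for [A] and [B] on the images of a
    monogenic: at [l], they relate the powers [l.+1] and [l]. *)
Definition coefA (a b r : K) (l : nat) : K :=
  (a + b + n%:R - 1 + l%:R) * (l.+1%:R * (r + a + n%:R + l%:R)).
Definition coefB (a b r : K) (k : nat) : K :=
  (a + b + n%:R - 1 + k%:R) * (k.+1%:R * (r - b - k%:R)).

(** The formula for the power [l.+1] contains the one for [l]: since
    [iter l.+1 raiseZ m] is [As (iter l raiseZ m)] up to the degree factor,
    [As (A _)] multiplies it by a scalar. *)
Lemma A_iterZ a b r m l : monogenic a b r m ->
  A (iter l.+1 T m) = coefA a b r l *: iter l T m.
Proof.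
move=> mm; have hm := monogenic_harmonic mm; have [wm Am Bm] := mm.
have TZ : forall c F, T (c *: F) = c *: T F by exact: raiseZZ.
have Bl j : B (iter j T m) = 0 by rewrite (B_iterZ j hm) Bm iter_morph0.
rewrite /coefA; elim: l => [|l IHl].
  rewrite /= (A_raiseZ hm Bm) Am quad0 add0r scalerA.
  by congr (_ *: _); ring.
have As_l : As (A (iter l.+1 T m)) =
    (l.+1%:R * (r + a + n%:R + l%:R)) *: iter l.+1 T m.
  rewrite IHl quadZ iterS (raiseZ_weight (harmonic_iterZ l hm).1) Bl quad0.
  rewrite subr0 scalerA; congr (_ *: _); ring.
rewrite iterS (A_raiseZ (harmonic_iterZ l.+1 hm) (Bl _)) As_l -scalerDl scalerA.
by congr (_ *: _); ring.
Qed.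

Lemma B_iterW a b r m k : monogenic a b r m ->
  B (iter k.+1 Y m) = coefB a b r k *: iter k Y m.
Proof.
move=> mm; have hm := monogenic_harmonic mm; have [wm Am Bm] := mm.
have YZ : forall c F, Y (c *: F) = c *: Y F by exact: raiseWZ.
have Ak j : A (iter j Y m) = 0 by rewrite (A_iterW j hm) Am iter_morph0.
rewrite /coefB; elim: k => [|k IHk].
  rewrite /= (B_raiseW hm Am) Bm quad0 add0r scalerA.
  by congr (_ *: _); ring.
have Bs_k : Bs (B (iter k.+1 Y m)) =
    (k.+1%:R * (r - b - k%:R)) *: iter k.+1 Y m.
  rewrite IHk quadZ iterS (raiseW_weight (harmonic_iterW k hm).1) Ak quad0.
  rewrite subr0 scalerA; congr (_ *: _); ring.
rewrite iterS (B_raiseW (harmonic_iterW k.+1 hm) (Ak _)) Bs_k -scalerDl scalerA.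
by congr (_ *: _); ring.
Qed.

Definition embedding k l m := iter k Y (iter l T m).

Lemma embeddingZ k l c m : embedding k l (c *: m) = c *: embedding k l m.
Proof. by rewrite /embedding (iter_morphZ _ raiseZZ) (iter_morphZ _ raiseWZ). Qed.

Lemma A_embedding0 a b r m k : monogenic a b r m -> A (embedding k 0 m) = 0.
Proof.
move=> mm; rewrite /embedding (A_iterW k (monogenic_harmonic mm)).
by have [_ -> _] := mm; rewrite iter_morph0 //; exact: raiseWZ.
Qed.

Lemma A_embedding a b r m k l : monogenic a b r m ->
  A (embedding k l.+1 m) = coefA a b r l *: embedding k l m.
Proof.
move=> mm; have hm := monogenic_harmonic mm.
rewrite /embedding (A_iterW k (harmonic_iterZ l.+1 hm)) (A_iterZ l mm).
by rewrite iter_morphZ //; exact: raiseWZ.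
Qed.

Lemma B_embedding0 a b r m l : monogenic a b r m -> B (embedding 0 l m) = 0.
Proof.
move=> mm; rewrite /embedding (B_iterZ l (monogenic_harmonic mm)).
by have [_ _ ->] := mm; rewrite iter_morph0 //; exact: raiseZZ.
Qed.

Lemma B_embedding a b r m k l : monogenic a b r m ->
  B (embedding k.+1 l m) = coefB a b r k *: embedding k l m.
Proof.
move=> mm; have hm := monogenic_harmonic mm.
rewrite /embedding !(iterWZ_comm _ l hm).
rewrite (B_iterZ l (harmonic_iterW k.+1 hm)) (B_iterW k mm).
by rewrite iter_morphZ //; exact: raiseZZ.
Qed.

Lemma iterA_embedding a b r m k l j : monogenic a b r m ->
  iter j A (embedding k (l + j) m) =
  (\prod_(i < j) coefA a b r (l + i)) *: embedding k l m.
Proof.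
move=> mm; elim: j => [|j IHj]; first by rewrite addn0 big_ord0 scale1r.
rewrite iterSr addnS (A_embedding k _ mm) (iter_morphZ _ (quadZ _ _)) IHj.
by rewrite scalerA big_ord_recr /= mulrC.
Qed.

Lemma iterB_embedding a b r m k l j : monogenic a b r m ->
  iter j B (embedding (k + j) l m) =
  (\prod_(i < j) coefB a b r (k + i)) *: embedding k l m.
Proof.
move=> mm; elim: j => [|j IHj]; first by rewrite addn0 big_ord0 scale1r.
rewrite iterSr addnS (B_embedding _ l mm) (iter_morphZ _ (quadZ _ _)) IHj.
by rewrite scalerA big_ord_recr /= mulrC.
Qed.

Lemma iterA_embedding_eq0 a b r m k l j : monogenic a b r m -> (l < j)%N ->
  iter j A (embedding k l m) = 0.
Proof.
move=> mm /subnK <-; rewrite iterD iterS -[in embedding k l m](add0n l).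
rewrite (iterA_embedding k 0 l mm) quadZ (A_embedding0 k mm) scaler0.
by rewrite iter_morph0 //; exact: quadZ.
Qed.

Lemma iterB_embedding_eq0 a b r m k l j : monogenic a b r m -> (k < j)%N ->
  iter j B (embedding k l m) = 0.
Proof.
move=> mm /subnK <-; rewrite iterD iterS -[in embedding k l m](add0n k).
rewrite (iterB_embedding 0 l k mm) quadZ (B_embedding0 l mm) scaler0.
by rewrite iter_morph0 //; exact: quadZ.
Qed.

(** The first power [j.+1] at which [coefB] vanishes gives a vector killed by [B]
    whose degree in u is smaller than its degree in w; such a vector is zero. If
    there is no such power up to [k], then [m] itself has these properties. *)
Lemma iterW_eq0 a b s m k e : monogenic a b s m -> s - b = k%:R - e.+1%:R ->
  iter k Y m = 0.
Proof.
move=> mm sb; have YZ : forall c F, Y (c *: F) = c *: Y F by exact: raiseWZ.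
have hm := monogenic_harmonic mm; have [wm Am Bm] := mm.
have [lke|] := ltnP k e.+1.
  rewrite (iterB_eq0 (p := 1) (e := e - k) wm) ?iter_morph0 //.
  by rewrite sb add1n -subSn // natrB 1?ltnW // opprB.
move=> lek; rewrite -(subnK (_ : (k - e.+1).+1 <= k)%N); last by lia.
rewrite iterD; set j := (k - e.+1)%N; have jE : s - b = j%:R by rewrite sb natrB.
rewrite (_ : iter j.+1 Y m = 0) ?iter_morph0 //.
apply: (iterB_eq0 (p := 1) (e := j.+1) (harmonic_iterW j.+1 hm).1).
  by rewrite -(opprK b) opprD opprK addrACA -opprD; 
     rewrite (_ : s + - b = j%:R) //; ring.
rewrite /= -iterS (B_iterW j mm) /coefB jE subrr !mulr0 scale0r //.
Qed.

(** ** Decomposition of the harmonics *)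

Hypothesis n_gt1 : (1 < n)%N.

Lemma iter_sum (f : V -> V) k (I : Type) (s : seq I) (P : pred I) (F : I -> V) :
    {morph f : F G / F + G} -> (forall c F, f (c *: F) = c *: f F) ->
  iter k f (\sum_(i <- s | P i) F i) = \sum_(i <- s | P i) iter k f (F i).
Proof.
move=> fD fZ.
by apply: (big_morph _ (iter_morphD k fD) (iter_morph0 k fZ)).
Qed.

Lemma degree_neq0 (i j k : nat) : i%:R + j%:R + n%:R - 1 + k%:R != 0 :> K.
Proof.
have -> : n%:R = n.-1%:R + 1 :> K by rewrite natr1 prednK // ltnW.
rewrite addrA addrK -!natrD pnatr_eq0; lia.
Qed.

Lemma harmonicB a b r F G : HW a b r F -> HW a b r G -> HW a b r (F - G).
Proof.
move=> [wF hF] [wG hG]; split; last by rewrite quadD quadN hF hG subrr.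
by apply: weightD => //; rewrite -scaleN1r; apply: weightZ.
Qed.

Lemma harmonicZ a b r c F : HW a b r F -> HW a b r (c *: F).
Proof.
by move=> [wF hF]; split; [apply: weightZ|rewrite quadZ hF scaler0].
Qed.

Lemma harmonic_sum a b r (I : Type) (s : seq I) (P : pred I) (F : I -> V) :
  (forall i, P i -> HW a b r (F i)) -> HW a b r (\sum_(i <- s | P i) F i).
Proof.
move=> h; split; first by apply: weight_sum => i /h[].
by rewrite quad_sum big1 // => i /h[].
Qed.

Lemma harmonic_embedding a b r k l m : HW a b r m ->
  HW (a + l%:R) (b + k%:R) (r + l%:R - k%:R) (embedding k l m).
Proof. by move=> hm; apply/harmonic_iterW/harmonic_iterZ. Qed.

Lemma monogenic_eq a b r a' b' r' F :
  a = a' -> b = b' -> r = r' -> monogenic a b r F -> monogenic a' b' r' F.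
Proof. by move=> <- <- <-. Qed.

Lemma harmonic_eq a b r a' b' r' F :
  a = a' -> b = b' -> r = r' -> HW a b r F -> HW a' b' r' F.
Proof. by move=> <- <- <-. Qed.

(** Induction on the degree in w: a preimage [G] of [B F] is built term by term. *)
Lemma kerA_decomposition (a b r : nat) F : HW a%:R b%:R r%:R F -> A F = 0 ->
  exists m : nat -> V,
    (forall k, (k <= b)%N -> monogenic a%:R (b - k)%:R (r + k)%:R (m k)) /\
    F = \sum_(k < b.+1) iter k Y (m k).
Proof.
have YZ : forall c F, Y (c *: F) = c *: Y F by exact: raiseWZ.
elim: b r F => [|b IHb] r F hF AF.
  exists (fun=> F); split; last by rewrite big_ord1.
  move=> k; rewrite leqn0 => /eqP->; rewrite subn0 addn0.
  split=> //; first by case: hF.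
  have [[_ hW _] _] := harmonic_B hF.
  by apply: (@number_neg KW 0); rewrite hW; congr (_ *: _); ring.
have hBF : HW a%:R b%:R r.+1%:R (B F).
  by apply: harmonic_eq (harmonic_B hF); rewrite // -natr1; ring.
have ABF : A (B F) = 0 by case: hF => _ hF; rewrite A_B AF hF quad0 addr0.
have {IHb}[m [mono BF]] := IHb _ _ hBF ABF.
(* Where the coefficient vanishes, the inverse is zero and the term is dropped. *)
pose coef k := coefB a%:R (b - k)%:R (r.+1 + k)%:R k.
pose G := \sum_(k < b.+1) iter k.+1 Y ((coef k)^-1 *: m k).
have hG : HW a%:R b.+1%:R r%:R G.
  apply: harmonic_sum => -[k klt] _; rewrite (iter_morphZ _ YZ); apply: harmonicZ.
  apply: harmonic_eq (harmonic_iterW k.+1 (monogenic_harmonic (mono k klt))) => //.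
    by rewrite -natrD /=; congr _%:R; lia.
  by rewrite addSnnS natrD addrK.
have AG : A G = 0.
  rewrite quad_sum big1 // => -[k klt] _.
  rewrite -[iter _ _ _]/(embedding k.+1 0 _).
  by rewrite (A_embedding0 _ (monogenicZ _ (mono k klt))).
have BG : B (F - G) = \sum_(k < b.+1) (1 - coef k / coef k) *: iter k Y (m k).
  rewrite quadD quadN {1}BF quad_sum -sumrB; apply: eq_bigr => -[k klt] _ /=.
  rewrite -iterS (B_iterW k (monogenicZ _ (mono k klt))) (iter_morphZ _ YZ).
  by rewrite scalerA scalerBl scale1r.
have coef_eq0 k : (k <= b)%N -> coef k = 0 -> (r + 1 + k = b)%N.
  move=> kb /eqP; rewrite mulf_eq0 (negPf (degree_neq0 _ _ _)) /=.
  rewrite mulf_eq0 pnatr_eq0 /= -addrA -opprD -natrD subr_eq0 eqr_nat => /eqP.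
  lia.
have BFG : B (F - G) = 0.
  have [br|rb] := leqP b r.
    rewrite BG big1 // => -[k klt] _ /=; rewrite divff ?subrr ?scale0r //.
    by apply/eqP => /(coef_eq0 k klt); lia.
  (* At most one term of [B F] is unmatched, the one with [k = b - r - 1]; one
     more power of [B] kills it, so [iterB_eq0] applies to [F - G]. *)
  suff -> : F - G = 0 by rewrite quad0.
  apply: (iterB_eq0 (p := (b - r).+1) (e := 0) (harmonicB hF hG).1).
    by rewrite addn0 -subSn 1?ltnW // natrB ?opprB // ltnW // ltnW.
  rewrite iterSr BG (iter_sum _ _ _ _ (quadD _ _) (quadZ _ _)) big1 // => -[k klt] _ /=.
  rewrite (iter_morphZ _ (quadZ _ _)).
  have [c0|c0] := eqVneq (coef k) 0; last by rewrite divff ?subrr ?scale0r.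
  rewrite -[iter k Y _]/(embedding k 0 _).
  rewrite (iterB_embedding_eq0 _ (mono k klt)) ?scaler0 //.
  by have := coef_eq0 k klt c0; lia.
exists (fun k => if k is k'.+1 then (coef k')^-1 *: m k' else F - G).
split; last by rewrite big_ord_recl /= subrK.
case=> [_|k klt].
  rewrite subn0 addn0; split=> //; first by case: (harmonicB hF hG).
  by rewrite quadD quadN AF AG subrr.
rewrite subSS -addSnnS; apply/monogenicZ/mono; exact: klt.
Qed.

(** Induction on the degree in z; no coefficient vanishes here, and the remainder
    is in the kernel of [A]. *)
Lemma harmonic_decomposition (a b r : nat) F : HW a%:R b%:R r%:R F ->
  exists m : nat -> nat -> V,
    (forall l k, (l <= a)%N -> (k <= b)%N ->
       monogenic (a - l)%:R (b - k)%:R (r%:R - l%:R + k%:R) (m l k)) /\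
    F = \sum_(l < a.+1) \sum_(k < b.+1) embedding k l (m l k).
Proof.
have YZ : forall c F, Y (c *: F) = c *: Y F by exact: raiseWZ.
have TZ : forall c F, T (c *: F) = c *: T F by exact: raiseZZ.
elim: a r F => [|a IHa] r F hF.
  have AF : A F = 0.
    have [[hZ _ _] _] := harmonic_A hF.
    by apply: (@number_neg KZ 0); rewrite hZ; congr (_ *: _); ring.
  have [m [mono ->]] := kerA_decomposition hF AF.
  exists (fun=> m); split; last by rewrite big_ord1.
  move=> l k; rewrite leqn0 => /eqP-> kb; rewrite subn0 subr0 -natrD.
  exact: mono.
case: r => [|r] in hF *.
  have AF : A F = 0.
    have [[_ _ hU] _] := harmonic_A hF.
    by apply: (@number_neg KU 0); rewrite hU; congr (_ *: _); ring.
  have [m [mono ->]] := kerA_decomposition hF AF.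
  exists (fun l => if l is 0%N then m else fun=> 0); split.
    move=> [|l] k la kb; last exact: monogenic0.
    by rewrite subn0 subr0 -natrD; apply: mono.
  rewrite [RHS]big_ord_recl /= [X in _ + X]big1 ?addr0 // => l _.
  by rewrite big1 // => k _; rewrite /embedding !iter_morph0.
have hAF : HW a%:R b%:R r%:R (A F).
  by apply: harmonic_eq (harmonic_A hF); rewrite -?natr1; ring.
have {IHa}[m [mono AF]] := IHa _ _ hAF.
pose coef l k := coefA (a - l)%:R (b - k)%:R (r%:R - l%:R + k%:R) l.
have coef_neq0 l k : (l <= a)%N -> coef l k != 0.
  move=> la; rewrite mulf_neq0 ?degree_neq0 // mulf_neq0 ?pnatr_eq0 //.
  rewrite [X in X != 0](_ : _ = (r + k + (a - l) + n)%:R); last by ring.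
  by rewrite pnatr_eq0; lia.
pose m' l k := (coef l k)^-1 *: m l k.
pose G := \sum_(l < a.+1) \sum_(k < b.+1) embedding k l.+1 (m' l k).
have mono' l k : (l <= a)%N -> (k <= b)%N ->
    monogenic (a - l)%:R (b - k)%:R (r%:R - l%:R + k%:R) (m' l k).
  by move=> la kb; apply/monogenicZ/mono.
have hG : HW a.+1%:R b%:R r.+1%:R G.
  apply: harmonic_sum => -[l la] _; apply: harmonic_sum => -[k kb] _ /=.
  apply: harmonic_eq (harmonic_embedding k l.+1 (monogenic_harmonic (mono' l k la kb))).
  - by rewrite -natrD; congr _%:R; lia.
  - by rewrite -natrD; congr _%:R; lia.
  - by ring.
have AFG : A (F - G) = 0.
  rewrite quadD quadN AF quad_sum -sumrB big1 // => -[l la] _.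
  rewrite quad_sum -sumrB big1 // => -[k kb] _ /=.
  rewrite (A_embedding k l (mono' l k la kb)) embeddingZ scalerA divff ?coef_neq0 //.
  by rewrite scale1r subrr.
have [m0 [mono0 FG]] := kerA_decomposition (harmonicB hF hG) AFG.
exists (fun l k => if l is l'.+1 then m' l' k else m0 k); split.
  move=> [|l] k la kb; first by rewrite subn0 subr0 -natrD; apply: mono0.
  by rewrite subSS; apply: monogenic_eq (mono' l k la kb) => //; ring.
by rewrite big_ord_recl /= -[F in LHS](subrK G) FG.
Qed.

(** ** Independence *)

(** Among the nonzero terms, one of maximal total exponent [l + (b - i)] is
    isolated by applying [A] and [B] as many times as [raiseZ] and [raiseW] occur
    in it. *)
Lemma embedding_independent (a b r : nat) (m : 'I_a.+1 * 'I_b.+1 -> V) :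
    (forall p : 'I_a.+1 * 'I_b.+1, (p.2 + p.1 <= r)%N ->
       monogenic (a - p.1)%:R p.2%:R (b + r - (p.2 + p.1))%:R (m p)) ->
    \sum_(p : 'I_a.+1 * 'I_b.+1 | (p.2 + p.1 <= r)%N)
      embedding (b - p.2) p.1 (m p) = 0 ->
  forall p : 'I_a.+1 * 'I_b.+1, (p.2 + p.1 <= r)%N -> embedding (b - p.2) p.1 (m p) = 0.
Proof.
move=> mono sum0 p pr; apply/eqP/negPn/negP => np0.
pose P (p : 'I_a.+1 * 'I_b.+1) :=
  (p.2 + p.1 <= r)%N && (embedding (b - p.2) p.1 (m p) != 0).
have Pp : P p by rewrite /P pr.
case: (@arg_maxnP _ p P (fun p => p.1 + (b - p.2))%N Pp) => {p pr np0 Pp}.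
move=> [l i] /= /andP[/= pr np0] pmax.
have /(congr1 (fun F => iter l A (iter (b - i) B F))) := sum0.
rewrite (iter_sum _ _ _ _ (quadD _ _) (quadZ _ _)).
rewrite (iter_sum _ _ _ _ (quadD _ _) (quadZ _ _)).
rewrite !(iter_morph0 _ (quadZ _ _)) (bigD1 (l, i)) //= big1 => [|[l' i'] /=].
  have mp := mono (l, i) pr.
  have := iterB_embedding 0 l (b - i) mp; rewrite add0n => ->.
  rewrite (iter_morphZ _ (quadZ _ _)).
  have := iterA_embedding 0 0 l mp; rewrite add0n => -> /=; rewrite addr0.
  move=> /eqP; rewrite !scaler_eq0 !prodf_seq_eq0 => /or3P[||/eqP m0].
  - case/hasP=> -[k kb] _ /=; rewrite mulf_eq0 (negPf (degree_neq0 _ _ _)) /=.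
    rewrite add0n mulf_eq0 pnatr_eq0 /= -addrA -opprD -natrD subr_eq0 eqr_nat.
    lia.
  - case/hasP=> -[k ka] _ /=; rewrite mulf_eq0 (negPf (degree_neq0 _ _ _)) /=.
    by rewrite mulf_eq0 pnatr_eq0 /= -!natrD pnatr_eq0; lia.
  by rewrite m0 /embedding (iter_morph0 _ raiseZZ) (iter_morph0 _ raiseWZ) eqxx in np0.
move=> /andP[pr' ne].
have [->|np0'] := eqVneq (embedding (b - i') l' (m (l', i'))) 0.
  by rewrite !iter_morph0 //; exact: quadZ.
have := pmax (l', i'); rewrite /P /= pr' np0' => /(_ isT) le.
have mp' := mono (l', i') pr'.
have [lk|gk] := ltnP (b - i') (b - i).
  by rewrite (iterB_embedding_eq0 _ mp' lk) iter_morph0 //; exact: quadZ.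
rewrite -(subnK gk) (iterB_embedding _ _ _ mp') (iter_morphZ _ (quadZ _ _)).
rewrite (iterA_embedding_eq0 _ mp') ?scaler0 //.
rewrite ltn_neqAle; apply/andP; split; last by lia.
apply: contraNneq ne => ll; rewrite xpair_eqE -!val_eqE /= ll eqxx /=.
have := ltn_ord i; have := ltn_ord i'; lia.
Qed.

(** The terms of [harmonic_decomposition] with [r < i + l] vanish. *)
Lemma harmonic_span (a b r : nat) F : HW a%:R b%:R r%:R F ->
  exists m : 'I_a.+1 * 'I_b.+1 -> V,
    (forall p : 'I_a.+1 * 'I_b.+1, (p.2 + p.1 <= r)%N ->
       monogenic (a - p.1)%:R p.2%:R (b + r - (p.2 + p.1))%:R (m p)) /\
    F = \sum_(p : 'I_a.+1 * 'I_b.+1 | (p.2 + p.1 <= r)%N) embedding (b - p.2) p.1 (m p).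
Proof.
move=> /harmonic_decomposition[m [mono ->]].
exists (fun p : 'I_a.+1 * 'I_b.+1 => m p.1 (b - p.2)%N); split=> [[l i] /= lir|].
  have ib := ltn_ord i; apply: monogenic_eq (mono l (b - i)%N _ (leq_subr _ _)).
  - by [].
  - by rewrite subKn.
  - by rewrite !natrB ?natrD; [ring|lia|lia].
  - by rewrite -ltnS ltn_ord.
rewrite [RHS]big_mkcond pair_big /=.
rewrite (reindex (fun p : 'I_a.+1 * 'I_b.+1 => (p.1, rev_ord p.2))) /=; last first.
  by exists (fun p => (p.1, rev_ord p.2)) => -[l i] _ /=; rewrite rev_ordK.
apply: eq_bigr => -[l i] _ /=; rewrite subSS.
case: ifPn => // lir; have ib : (i <= b)%N by rewrite -ltnS.
have la : (l <= a)%N by rewrite -ltnS.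
have mm := mono l (b - i)%N la (leq_subr _ _).
rewrite /embedding (iterWZ_comm _ _ (monogenic_harmonic mm)).
rewrite (iterW_eq0 (e := (i + l - r).-1) mm).
  by rewrite iter_morph0 //; exact: raiseZZ.
rewrite prednK ?subn_gt0 ?ltnNge // subKn // !natrB //; last by rewrite ltnW // ltnNge.
by rewrite natrD; ring.
Qed.
End Quadratic.

(** * The polynomial Fock model *)

Notation monom := mpoly.multinom.
Notation "''Xm_[' m ]" := (mpoly.mpolyX _ m) (format "''Xm_[' m ]").
Notation "''Um_' i" := (mpoly.mnm1 i) (at level 2, format "''Um_' i").
Notation fock n K := (mpoly.mpoly (n + n + n) K).

Section LinearExtension.
Context {K : nzRingType} {N : nat}.
Implicit Types (P Q : mpoly.mpoly N K) (g : monom N -> K).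

Definition linear_ext g P : K :=
  \sum_(m <- mpoly.msupp P) mpoly.mcoeff m P * g m.

Lemma linear_extE g P (s : seq (monom N)) :
    uniq s -> {subset mpoly.msupp P <= s} ->
  linear_ext g P = \sum_(m <- s) mpoly.mcoeff m P * g m.
Proof.
move=> us sub; rewrite [RHS](bigID (mem (mpoly.msupp P))) /=.
rewrite [X in _ = _ + X]big1 => [|m /mpoly.memN_msupp_eq0->]; last exact: mul0r.
rewrite addr0 -[RHS]big_filter; apply/perm_big/uniq_perm.
- exact: mpoly.msupp_uniq.
- exact: filter_uniq.
by move=> m; rewrite mem_filter; case: (boolP (m \in _)) => // /sub ->.
Qed.

Lemma linear_ext_is_linear g c P Q :
  linear_ext g (c *: P + Q) = c * linear_ext g P + linear_ext g Q.
Proof.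
pose s := undup (mpoly.msupp P ++ mpoly.msupp Q).
have us : uniq s by exact: undup_uniq.
rewrite !(@linear_extE _ _ s) //; first last.
- move=> m; rewrite mem_undup mem_cat => /mpoly.msuppD_le.
  by rewrite mem_cat => /orP[/mpoly.msuppZ_le->|->]; rewrite ?orbT.
- by move=> m; rewrite mem_undup mem_cat => ->.
- by move=> m; rewrite mem_undup mem_cat => ->; rewrite orbT.
rewrite mulr_sumr -big_split; apply: eq_bigr => m _ /=.
by rewrite mpoly.mcoeffD mpoly.mcoeffZ mulrDl mulrA.
Qed.

Lemma linear_extX g m : linear_ext g 'Xm_[m] = g m.
Proof.
by rewrite /linear_ext mpoly.msuppX big_seq1 mpoly.mcoeffX eqxx mul1r.
Qed.

End LinearExtension.

Section Fock.
Context {K : numFieldType} {n : nat}.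
Implicit Types (P Q : fock n K) (m : monom (n + n + n)).

Definition var (v : kind) (j : 'I_n) : 'I_(n + n + n) :=
  match v with
  | KZ => lshift n (lshift n j)
  | KW => lshift n (rshift n j)
  | KU => rshift (n + n) j
  end.

Lemma var_eq v v' j k : (var v j == var v' k) = same_kind v v' && (j == k).
Proof.
by case: v; case: v' => /=; rewrite ?eq_lshift ?eq_rshift ?eq_lrshift ?eq_rlshift
  ?eq_lshift ?eq_rshift ?eq_lrshift ?eq_rlshift.
Qed.

Lemma var_cases (i : 'I_(n + n + n)) : exists v j, i = var v j.
Proof.
case: (split_ordP i) => [k ->|k ->]; last by exists KU, k.
by case: (split_ordP k) => [j ->|j ->]; [exists KZ, j|exists KW, j].
Qed.

Definition fock_act (x : generator) (j : 'I_n) P : fock n K :=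
  match x with
  | Mul v => 'Xm_['Um_(var v j)] * P
  | Der v => mpoly.mderiv (var v j) P
  end.

Lemma fock_act_is_linear x j : linear (fock_act x j).
Proof.
by case: x => v c P Q /=; [rewrite mulrDr scalerAr|rewrite linearP].
Qed.

HB.instance Definition _ x j := GRing.isLinear.Build K _ _ _ _ (fock_act_is_linear x j).

Lemma fock_actD x j P Q : fock_act x j (P + Q) = fock_act x j P + fock_act x j Q.
Proof. exact: linearD. Qed.

Lemma fock_actN x j P : fock_act x j (- P) = - fock_act x j P.
Proof. exact: linearN. Qed.

Lemma fock_actZ x j c P : fock_act x j (c *: P) = c *: fock_act x j P.
Proof. exact: linearZ. Qed.

Definition fock_actE := (fock_actD, fock_actN, fock_actZ).

Lemma mderivU (i k : 'I_(n + n + n)) :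
  mpoly.mderiv i 'Xm_['Um_k] = (i == k)%:R :> fock n K.
Proof.
rewrite mpoly.mderivX mpoly.mnm1E eq_sym; case: eqVneq => [->|_].
  rewrite scale1r (_ : mpoly.mnm_sub _ _ = mpoly.mnm0) ?mpoly.mpolyX0 //.
  by apply/mpoly.mnmP => l; rewrite mpoly.mnmBE subnn mpoly.mnm0E.
by rewrite scale0r.
Qed.

Lemma fock_ccr x y j k P :
  fock_act x j (fock_act y k P) =
  fock_act y k (fock_act x j P) + ((j == k)%:R * kappa x y) *: P.
Proof.
case: x => v; case: y => v' /=.
- by rewrite mulr0 scale0r addr0 mulrCA.
- rewrite mpoly.mderivM mderivU var_eq eq_sym.
  have -> : same_kind v' v = same_kind v v' by case: v; case: v'.
  case: (same_kind v v') (j == k) => [] [];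
    rewrite /= ?(mulr0, mul0r, mul1r, scale0r, add0r, addr0) //.
  by rewrite scaleN1r addrAC subrr add0r.
- rewrite mpoly.mderivM mderivU var_eq.
  case: (same_kind v v') (j == k) => [] [];
    rewrite /= ?(mulr0, mul0r, mul1r, scale0r, add0r, addr0) //.
  by rewrite scale1r addrC.
- by rewrite mulr0 scale0r addr0 mpoly.mderiv_comm.
Qed.

Definition mon_degree (v : kind) m : nat := \sum_j m (var v j).

Lemma mulU_mderivX (i : 'I_(n + n + n)) m :
  'Xm_['Um_i] * mpoly.mderiv i 'Xm_[m] = (m i)%:R *: 'Xm_[m] :> fock n K.
Proof.
rewrite mpoly.mderivX -scalerAr; case: (posnP (m i)) => [->|mi].
  by rewrite !scale0r.
by rewrite mulrC -mpoly.mpolyXD mpoly.submK // mpoly.lep1mP -lt0n.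
Qed.

Lemma number_monomial v m :
  quad fock_act (Mul v) (Der v) 'Xm_[m] = (mon_degree v m)%:R *: 'Xm_[m].
Proof.
rewrite /mon_degree natr_sum scaler_suml; apply: eq_bigr => j _.
exact: mulU_mderivX.
Qed.

Lemma mcoeff_number v P m :
  mpoly.mcoeff m (quad fock_act (Mul v) (Der v) P) =
  (mon_degree v m)%:R * mpoly.mcoeff m P.
Proof.
elim/mpoly.mpolyind: P => [|c m' P _ _ IHP].
  by rewrite quad0 mpoly.mcoeff0 mulr0.
rewrite quadD quadZ number_monomial !mpoly.mcoeffD !mpoly.mcoeffZ IHP.
rewrite mpoly.mcoeffX mulrDr; congr (_ + _).
by case: eqVneq => [->|_]; rewrite ?mulr0 // mulrCA.
Qed.

(** Monomials are eigenvectors of the degree operators, so any monomial of an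
    eigenvector has its eigenvalue as degree. *)
Lemma fock_eigenvalue v t P m :
    quad fock_act (Mul v) (Der v) P = t *: P -> m \in mpoly.msupp P ->
  t = (mon_degree v m)%:R.
Proof.
move=> /(congr1 (mpoly.mcoeff m)); rewrite mcoeff_number mpoly.mcoeffZ.
by rewrite mpoly.mcoeff_msupp => h m0; apply: (mulIf m0).
Qed.

Lemma fock_number_nat v t P :
    quad fock_act (Mul v) (Der v) P = t *: P -> P != 0 ->
  exists k : nat, t = k%:R.
Proof.
move=> hP; rewrite -mpoly.msupp_eq0; case E: (mpoly.msupp P) => [//|m s] _.
by exists (mon_degree v m); apply: fock_eigenvalue hP _; rewrite E mem_head.
Qed.

Notation fweight := (weight (@fock_act)).

Lemma weight_monomial m : fweight (mon_degree KZ m)%:R (mon_degree KW m)%:R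
  (mon_degree KU m)%:R 'Xm_[m].
Proof. by split; apply: number_monomial. Qed.

Lemma weight_msupp (a b r : nat) P m : fweight a%:R b%:R r%:R P ->
    m \in mpoly.msupp P ->
  [/\ mon_degree KZ m = a, mon_degree KW m = b & mon_degree KU m = r].
Proof.
by move=> [hZ hW hU] mP; split; apply/eqP; rewrite -(eqr_nat K);
  apply/eqP/esym; [apply: fock_eigenvalue hZ mP|apply: fock_eigenvalue hW mP|
  apply: fock_eigenvalue hU mP].
Qed.

Definition umonom (g : 'I_n -> nat) : monom (n + n + n) :=
  mpoly.Multinom [tuple if fintype.split i is inr j then g j else 0%N | i < n + n + n].

Lemma umonomE g v j : umonom g (var v j) = if v is KU then g j else 0%N.
Proof.
rewrite mpoly.mnmE; case: v => /=; first by rewrite (unsplitK (inl _)).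
  by rewrite (unsplitK (inl _)).
by rewrite (unsplitK (inr _)).
Qed.

Lemma mulU_umonom g j :
  'Xm_['Um_(var KU j)] * 'Xm_[umonom g] =
  'Xm_[umonom (fun i => g i + (i == j))%N] :> fock n K.
Proof.
rewrite -mpoly.mpolyXD; congr 'Xm_[_]; apply/mpoly.mnmP => i.
have [v [k ->]] := var_cases i.
rewrite mpoly.mnmDE !umonomE mpoly.mnm1E var_eq.
by case: v => //=; rewrite addnC eq_sym.
Qed.

(** A polynomial of degree [r] in u is a combination of the products of a
    polynomial free of u with a monomial in u, and derivatives in u lead to its
    coefficients: by Euler's identity, [r *: Q] is the sum of the products of u_j
    with the derivative of [Q] in u_j. Stated as an induction principle, it keeps
    track of any property [S] of [Q] stable under these derivatives. *)
Lemma fock_euler_ind (S C : fock n K -> Prop) (a b r : nat) Q :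
    (forall j P, S P -> S (fock_act (Der KU) j P)) ->
    C 0 -> (forall c P P', C P -> C P' -> C (c *: P + P')) ->
    (forall P g, fweight a%:R b%:R 0 P -> S P -> (\sum_j g j)%N = r ->
       C (P * 'Xm_[umonom g])) ->
  fweight a%:R b%:R r%:R Q -> S Q -> C Q.
Proof.
move=> SD; elim: r Q C => [|r IHr] Q C C0 CD CX wQ SQ.
  have -> : Q = Q * 'Xm_[umonom (fun=> 0%N)].
    rewrite (_ : umonom _ = mpoly.mnm0) ?mpoly.mpolyX0 ?mulr1 //.
    apply/mpoly.mnmP => i; have [v [j ->]] := var_cases i.
    by rewrite umonomE mpoly.mnm0E; case: v.
  by apply: CX => //; rewrite big1.
have -> : Q = r.+1%:R^-1 *: quad fock_act (Mul KU) (Der KU) Q.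
  by case: wQ => _ _ ->; rewrite scalerA mulVf ?scale1r // pnatr_eq0.
rewrite -[X in C X]addr0; apply: (CD) => //.
apply: big_ind => [//|P P' CP CP'|j _]; first by rewrite -[P]scale1r; apply: CD.
pose Cj P := C (fock_act (Mul KU) j P).
apply: (IHr _ Cj); rewrite /Cj.
- by rewrite linear0.
- by move=> c P P' CP CP'; rewrite linearP; apply: CD.
- move=> P g wP SP gr; rewrite /= mulrCA mulU_umonom; apply: CX => //.
  rewrite big_split /= gr (bigD1 j) //= eqxx big1 ?addn0 ?addn1 // => i.
  by move/negPf->.
- have := weight_act fock_ccr (Der KU) j wQ.
  by apply: weight_eq; rewrite /= ?addr0 // -natr1 addrK.
- exact: SD.
Qed.

End Fock.

(** * Derivatives of complex-valued functions *)

Section ComplexDerivative.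
Context {R : realType}.
Notation C := R[i].
Implicit Types (f g : R -> C) (t : R) (c d : C).

Definition is_deriveC t f d : Prop :=
  is_derive t 1 (fun s => complex.Re (f s)) (complex.Re d) /\
  is_derive t 1 (fun s => complex.Im (f s)) (complex.Im d).

Lemma is_deriveC_eq t f d d' : is_deriveC t f d -> d = d' -> is_deriveC t f d'.
Proof. by move=> ? <-. Qed.

Lemma is_deriveC_cst t c : is_deriveC t (fun=> c) 0.
Proof. by split; apply: is_derive_cst. Qed.

Lemma is_deriveC_real t (h : R -> R) (d : R) :
  is_derive t 1 h d -> is_deriveC t (fun s => (h s)%:C) d%:C.
Proof. by move=> dh; split => //=; apply: is_derive_cst. Qed.

Lemma is_deriveCD t f g df dg : is_deriveC t f df -> is_deriveC t g dg ->
  is_deriveC t (fun s => f s + g s) (df + dg).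
Proof.
move=> [f1 f2] [g1 g2]; split.
  rewrite (_ : (fun s => _) =
    (fun s => complex.Re (f s)) + (fun s => complex.Re (g s))).
    by apply: is_derive_eq (is_deriveD f1 g1) _; case: df {f1 f2}; case: dg {g1 g2}.
  apply/funext => s; rewrite -[RHS]/(complex.Re (f s) + complex.Re (g s)).
  by case: (f s); case: (g s).
rewrite (_ : (fun s => _) =
  (fun s => complex.Im (f s)) + (fun s => complex.Im (g s))).
  by apply: is_derive_eq (is_deriveD f2 g2) _; case: df {f1 f2}; case: dg {g1 g2}.
apply/funext => s; rewrite -[RHS]/(complex.Im (f s) + complex.Im (g s)).
by case: (f s); case: (g s).
Qed.

Lemma is_deriveCM t f g df dg : is_deriveC t f df -> is_deriveC t g dg ->
  is_deriveC t (fun s => f s * g s) (f t * dg + g t * df).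
Proof.
move=> [f1 f2] [g1 g2]; split.
  rewrite (_ : (fun s => _) =
    (fun s => complex.Re (f s)) * (fun s => complex.Re (g s)) -
    (fun s => complex.Im (f s)) * (fun s => complex.Im (g s))); last first.
    apply/funext => s; rewrite -[RHS]/(complex.Re (f s) * complex.Re (g s) -
      complex.Im (f s) * complex.Im (g s)).
    by case: (f s); case: (g s).
  apply: is_derive_eq (is_deriveB (is_deriveM f1 g1) (is_deriveM f2 g2)) _.
  case: (f t) => a b; case: (g t) => c d.
  case: df {f1 f2} => u v; case: dg {g1 g2} => w x /=; rewrite /GRing.scale /=; ring.
rewrite (_ : (fun s => _) =
  (fun s => complex.Re (f s)) * (fun s => complex.Im (g s)) +
  (fun s => complex.Im (f s)) * (fun s => complex.Re (g s))); last first.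
  apply/funext => s; rewrite -[RHS]/(complex.Re (f s) * complex.Im (g s) +
    complex.Im (f s) * complex.Re (g s)).
  by case: (f s); case: (g s).
apply: is_derive_eq (is_deriveD (is_deriveM f1 g2) (is_deriveM f2 g1)) _.
case: (f t) => a b; case: (g t) => c d.
case: df {f1 f2} => u v; case: dg {g1 g2} => w x /=; rewrite /GRing.scale /=; ring.
Qed.

Lemma is_deriveCX t f df k : is_deriveC t f df ->
  is_deriveC t (fun s => f s ^+ k) (k%:R * f t ^+ k.-1 * df).
Proof.
move=> hf; elim: k => [|k IHk].
  rewrite !mul0r; exact: is_deriveC_cst.
under eq_fun do rewrite exprS.
apply: is_deriveC_eq (is_deriveCM hf IHk) _.
case: k {IHk} => [|k] /=; first by rewrite expr0; ring.
by rewrite exprS; set y := _ ^+ k; ring.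
Qed.

(** Restricting to lines reduces all the derivatives below to functions of one real
    variable. *)
Lemma deriveC_line (V : normedModType R) (v p : V) (F : V -> C) d :
  is_deriveC 0 (fun s => F (s *: v + p)) d -> deriveC v F p = d.
Proof.
have line (h : V -> R) (e : R) :
    is_derive (0 : R) (1 : R) (fun s : R => h (s *: v + p)) e -> 'D_v h p = e.
  case=> _ <-; apply: (f_equal (fun G : R -> R => lim (G @ 0^'))).
  by apply/funext => s /=; rewrite addr0 scale0r add0r [s *: 1]mulr1.
move=> [dRe dIm]; rewrite /deriveC (line (fun u => complex.Re (F u)) _ dRe).
by rewrite (line (fun u => complex.Im (F u)) _ dIm); case: d {dRe dIm}.
Qed.

End ComplexDerivative.

(** * The Fock model of spinor-valued polynomials *)

Section Local.
Context {R : realType}.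
Notation C := R[i].
Implicit Types (x y q : R) (a b c : nat).

Lemma hermiteS c : hermite c.+1 =
  2%:R *: 'X * hermite c - (2 * c)%:R *: hermite c.-1 :> {poly R}.
Proof. by case: c => // /=; rewrite mulr1 scale0r subr0. Qed.

(** The lowering relation for Hermite polynomials, on which the identification of
    [Lop] with 2 d/du rests. *)
Lemma deriv_hermite c : (hermite c)^`() = (2 * c)%:R *: hermite c.-1 :> {poly R}.
Proof.
elim/ltn_ind: c => -[|[|c]] IHc.
- by rewrite muln0 scale0r derivC.
- by rewrite /= derivZ derivX muln1.
rewrite [in LHS]hermiteS derivB derivM !derivZ derivX !IHc // !succnK.
rewrite (hermiteS c) -!mul_polyC !polyC_natr.
set H := hermite c; set H' := hermite c.-1; ring.
Qed.

(** The function of one pair (z_j, q_j) represented by z^a w^b u^c: the monomials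
    are represented by products of such functions, and a partial derivative acts on
    one factor only. *)
Definition local_basis a b c x y q : C :=
  (x +i* y) ^+ a * (x +i* - y) ^+ b *
  (expR (- q ^+ 2 / 2) * (hermite c).[q])%:C.

Lemma is_deriveC_local_x a b c x y q :
  is_deriveC 0 (fun t => local_basis a b c (t + x) y q)
    (a%:R * local_basis a.-1 b c x y q + b%:R * local_basis a b.-1 c x y q).
Proof.
have d1 e : is_deriveC 0 (fun t => (t + x) +i* e) 1.
  by split=> /=; [apply: is_derive_shift|apply: is_derive_cst].
apply: is_deriveC_eq.
  apply: is_deriveCM (is_deriveCM (is_deriveCX a (d1 y)) (is_deriveCX b (d1 (- y))))
    (is_deriveC_cst _ _).
by rewrite /= add0r /local_basis; ring.
Qed.

Lemma is_deriveC_local_y a b c x y q :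
  is_deriveC 0 (fun t => local_basis a b c x (t + y) q)
    ('i%C * (a%:R * local_basis a.-1 b c x y q - b%:R * local_basis a b.-1 c x y q)).
Proof.
have d1 : is_deriveC 0 (fun t => x +i* (t + y)) 'i%C.
  by split=> /=; [apply: is_derive_cst|apply: is_derive_shift].
have d2 : is_deriveC 0 (fun t => x +i* - (t + y)) (- 'i%C).
  split=> /=; first by rewrite oppr0; apply: is_derive_cst.
  by apply: is_deriveN; apply: is_derive_shift.
apply: is_deriveC_eq.
  apply: is_deriveCM (is_deriveCM (is_deriveCX a d1) (is_deriveCX b d2))
    (is_deriveC_cst _ _).
by rewrite /= add0r /local_basis; ring.
Qed.

(** Multiplication by q is half the sum of the annihilation and creation operators,
    and d/dq below is half their difference. *)
Lemma mulq_local a b c x y q : q%:C * local_basis a b c x y q =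
  c%:R * local_basis a b c.-1 x y q + 2^-1 * local_basis a b c.+1 x y q.
Proof.
have : q * (expR (- q ^+ 2 / 2) * (hermite c).[q]) =
    c%:R * (expR (- q ^+ 2 / 2) * (hermite c.-1).[q]) +
    2^-1 * (expR (- q ^+ 2 / 2) * (hermite c.+1).[q]) :> R.
  rewrite hermiteS hornerD hornerN hornerM !hornerZ hornerX; set e := expR _.
  by set H := horner _ _; set H' := horner _ _; field.
move=> /(congr1 (real_complex R)); rewrite rmorphD !(rmorphM (real_complex R)).
rewrite fmorphV !rmorph_nat /local_basis !(rmorphM (real_complex R)) /=.
move: ((x +i* y) ^+ a * _) => A; move: (expR _)%:C => e eq.
transitivity (A * (q%:C * (e * (hermite c).[q]%:C))); first by ring.
by rewrite eq; ring.
Qed.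

Lemma is_deriveC_local_q a b c x y q :
  is_deriveC 0 (fun t => local_basis a b c x y (t + q))
    (c%:R * local_basis a b c.-1 x y q - 2^-1 * local_basis a b c.+1 x y q).
Proof.
pose e := expR (- q ^+ 2 / 2).
have dsh : is_derive (0 : R) (1 : R) (shift q) 1 by exact: is_derive_shift.
have dsq : is_derive (0 : R) (1 : R) (fun t => - (t + q) ^+ 2 / 2) (- q).
  rewrite (_ : (fun t => _) = (- 2^-1) \*: (shift q ^+ 2)); last first.
    apply/funext => t; rewrite -[RHS]/(- 2^-1 * ((shift q ^+ 2) t)) !expr2.
    by rewrite -[(_ * _) t]/((t + q) * (t + q)); ring.
  apply: is_derive_eq (is_deriveZ (- 2^-1) (is_deriveX 2 dsh)) _.
  by rewrite /GRing.scale /= add0r; field.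
have de : is_derive (0 : R) (1 : R) (fun t => expR (- (t + q) ^+ 2 / 2)) (- q * e).
  have de := is_derive_expR (- (0 + q) ^+ 2 / 2).
  apply: is_derive_eq (@is_derive1_comp _ expR
    (fun t => - (t + q) ^+ 2 / 2) 0 _ _ de dsq) _.
  by rewrite add0r mulrC.
have dH : is_derive (0 : R) (1 : R) (fun t => (hermite c).[t + q])
    ((2 * c)%:R * (hermite c.-1).[q]).
  have dp := is_derive_poly (hermite c) (0 + q).
  apply: is_derive_eq (@is_derive1_comp _ _ (shift q) 0 _ _ dp dsh) _.
  by rewrite add0r deriv_hermite hornerZ mulr1.
have d0 : is_deriveC 0 (fun t => (expR (- (t + q) ^+ 2 / 2) * (hermite c).[t + q])%:C)
  (e * (2 * c)%:R * (hermite c.-1).[q] + (hermite c).[q] * (- q * e))%:C.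
  apply: is_deriveC_real; apply: is_derive_eq (is_deriveM de dH) _.
  by rewrite /GRing.scale /= add0r mulrA.
apply: is_deriveC_eq (is_deriveCM (is_deriveC_cst _ _) d0) _.
have : e * (2 * c)%:R * (hermite c.-1).[q] + (hermite c).[q] * (- q * e) =
    c%:R * (e * (hermite c.-1).[q]) - 2^-1 * (e * (hermite c.+1).[q]) :> R.
  rewrite hermiteS hornerD hornerN hornerM !hornerZ hornerX.
  by set H := horner _ _; set H' := horner _ _; field.
move=> ->; rewrite mulr0 addr0 rmorphB !(rmorphM (real_complex R)).
rewrite fmorphV !rmorph_nat /local_basis !(rmorphM (real_complex R)) /= -/e.
move: ((x +i* y) ^+ a * _) => A; ring.
Qed.

End Local.

Section Realization.
Context {R : realType} {n : nat}.
Notation C := R[i].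
Implicit Types (P Q : fock n C) (m : monom (n + n + n)) (w : zqspace R n).

Definition local_at m w (j : 'I_n) : C :=
  local_basis (m (var KZ j)) (m (var KW j)) (m (var KU j))
    (w.1.1 0 j) (w.1.2 0 j) (w.2 0 j).

Definition basis m w : C := \prod_j local_at m w j.

(** The inverse of the expansion in Hermite functions. *)
Definition realize P : zqspace R n -> C := fun w => linear_ext (basis^~ w) P.

Lemma realize_monomial m : realize 'Xm_[m] = basis m.
Proof. by apply/funext => w; rewrite /realize linear_extX. Qed.

Lemma realizeP c P Q : realize (c *: P + Q) = scale c (realize P) + realize Q.
Proof. by apply/funext => w; exact: linear_ext_is_linear. Qed.

Lemma realize0 : realize 0 = 0.
Proof.
by apply/funext => w; rewrite /realize /linear_ext mpoly.msupp0 big_nil.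
Qed.

Lemma realizeD P Q : realize (P + Q) = realize P + realize Q.
Proof.
rewrite -[P in LHS]scale1r realizeP; congr (_ + _).
by apply/funext => w; rewrite /scale mul1r.
Qed.

Lemma realizeZ c P : realize (c *: P) = scale c (realize P).
Proof. by rewrite -[c *: P]addr0 realizeP realize0 addr0. Qed.

Lemma realizeN P : realize (- P) = - realize P.
Proof.
rewrite -scaleN1r realizeZ; apply/funext => w.
by rewrite /scale mulN1r.
Qed.

Lemma realizeB P Q : realize (P - Q) = realize P - realize Q.
Proof. by rewrite realizeD realizeN. Qed.

Lemma realize_sum (I : Type) (s : seq I) (p : pred I) (f : I -> fock n C) :
  realize (\sum_(i <- s | p i) f i) = \sum_(i <- s | p i) realize (f i).
Proof. exact: (big_morph _ realizeD realize0). Qed.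

(** ** Intertwining relations *)

Lemma realize_mul (h : zqspace R n -> C) (D : {linear fock n C -> fock n C}) :
    (forall m w, h w * basis m w = realize (D 'Xm_[m]) w) ->
  forall P, (fun w => h w * realize P w) = realize (D P).
Proof.
move=> hD P; rewrite [in RHS](mpoly.mpolyE P) linear_sum realize_sum.
apply/funext => w; rewrite fct_sumE [X in h w * X]/realize mulr_sumr.
by apply: eq_bigr => m _; rewrite linearZ /= realizeZ /scale -hD mulrCA.
Qed.

Lemma is_deriveC_sum (I : Type) (s : seq I) (c d : I -> C) (f : I -> R -> C) t :
    (forall i, is_deriveC t (f i) (d i)) ->
  is_deriveC t (fun u => \sum_(i <- s) c i * f i u) (\sum_(i <- s) c i * d i).
Proof.
move=> df; elim: s => [|i s IHs].
  rewrite big_nil; under eq_fun do rewrite big_nil.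
  exact: is_deriveC_cst.
rewrite big_cons; under eq_fun do rewrite big_cons.
apply: is_deriveCD IHs.
apply: is_deriveC_eq (is_deriveCM (is_deriveC_cst _ _) (df i)) _.
by rewrite mulr0 addr0.
Qed.

Lemma realize_derive (v : zqspace R n) (D : {linear fock n C -> fock n C}) :
    (forall m w, is_deriveC 0 (fun t => basis m (t *: v + w))
       (realize (D 'Xm_[m]) w)) ->
  forall P, deriveC v (realize P) = realize (D P).
Proof.
move=> hD P; apply/funext => w; apply: deriveC_line.
rewrite [in realize (D P)](mpoly.mpolyE P) linear_sum realize_sum fct_sumE.
apply: is_deriveC_eq.
  exact: (is_deriveC_sum _ (fun m => mpoly.mcoeff m P) (fun m => hD m w)).
by apply: eq_bigr => m _; rewrite linearZ /= realizeZ.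
Qed.

Definition local_rest m w j : C := \prod_(i | i != j) local_at m w i.

(** A derivative in a direction of index [j] concerns the factor of index [j];
    [local_rest] is constant along such a direction. *)
Lemma basisD1 m w j : basis m w = local_at m w j * local_rest m w j.
Proof. by rewrite /basis (bigD1 j). Qed.

Lemma eq_local_rest m m' w w' j :
    (forall v i, i != j -> m (var v i) = m' (var v i)) ->
    (forall i, i != j -> [/\ w.1.1 0 i = w'.1.1 0 i, w.1.2 0 i = w'.1.2 0 i &
      w.2 0 i = w'.2 0 i]) ->
  local_rest m w j = local_rest m' w' j.
Proof.
move=> mm ww; apply: eq_bigr => i ij; have [e1 e2 e3] := ww i ij.
by rewrite /local_at !mm // e1 e2 e3.
Qed.

Lemma realize_Der v j m w :
  realize (fock_act (Der v) j 'Xm_[m]) w = (m (var v j))%:R *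
   (local_basis (m (var KZ j) - same_kind v KZ) (m (var KW j) - same_kind v KW)
     (m (var KU j) - same_kind v KU) (w.1.1 0 j) (w.1.2 0 j) (w.2 0 j) *
   local_rest m w j).
Proof.
rewrite /= mpoly.mderivX realizeZ realize_monomial /scale (basisD1 _ _ j).
congr (_ * (_ * _)); last apply: eq_local_rest => // v' i ij.
  by rewrite /local_at !mpoly.mnmBE !mpoly.mnm1E !var_eq eqxx !andbT.
rewrite mpoly.mnmBE mpoly.mnm1E var_eq eq_sym (negPf ij) andbF subn0 //.
Qed.

Lemma realize_Mul v j m w :
  realize (fock_act (Mul v) j 'Xm_[m]) w =
   local_basis (m (var KZ j) + same_kind v KZ) (m (var KW j) + same_kind v KW)
     (m (var KU j) + same_kind v KU) (w.1.1 0 j) (w.1.2 0 j) (w.2 0 j) *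
   local_rest m w j.
Proof.
rewrite /= -mpoly.mpolyXD realize_monomial (basisD1 _ _ j).
congr (_ * _); last apply: eq_local_rest => // v' i ij.
  rewrite /local_at !mpoly.mnmDE !mpoly.mnm1E !var_eq eqxx !andbT.
  by rewrite !(addnC (same_kind _ _)).
rewrite mpoly.mnmDE mpoly.mnm1E var_eq eq_sym (negPf ij) andbF //.
Qed.

Notation act := fock_act.

Lemma deltaE (j : 'I_n) (t : R) (x : 'rV[R]_n) :
  (t *: delta_mx 0 j + x) 0 j = t + x 0 j.
Proof. by rewrite !mxE !eqxx mulr1. Qed.

Lemma delta_neqE (j i : 'I_n) (t : R) (x : 'rV[R]_n) : i != j ->
  (t *: delta_mx 0 j + x) 0 i = x 0 i.
Proof. by move=> ij; rewrite !mxE (negPf ij) andbF mulr0 add0r. Qed.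

Lemma zeroE (i : 'I_n) (t : R) (x : 'rV[R]_n) : (t *: 0 + x) 0 i = x 0 i.
Proof. by rewrite scaler0 add0r. Qed.

Lemma is_deriveC_basis m w j (v : zqspace R n) d :
    (forall t i, i != j -> [/\ (t *: v + w).1.1 0 i = w.1.1 0 i,
       (t *: v + w).1.2 0 i = w.1.2 0 i & (t *: v + w).2 0 i = w.2 0 i]) ->
    is_deriveC 0 (fun t => local_at m (t *: v + w) j) d ->
  is_deriveC 0 (fun t => basis m (t *: v + w)) (d * local_rest m w j).
Proof.
move=> vj dj.
under eq_fun => t.
  rewrite (basisD1 _ _ j) (@eq_local_rest m m _ w) //; last exact: vj.
  over.
apply: is_deriveC_eq (is_deriveCM dj (is_deriveC_cst _ _)) _.
by rewrite mulr0 add0r mulrC.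
Qed.

(** With z = x + i y and w = x - i y, the chain rule gives the derivatives in x and
    y from those in z and w. *)
Lemma dx_realize j P :
  dx j (realize P) = realize (act (Der KZ) j P + act (Der KW) j P).
Proof.
apply: (realize_derive (D := act (Der KZ) j \+ act (Der KW) j)) => m w.
apply: is_deriveC_eq.
  apply: (@is_deriveC_basis _ _ j).
    by move=> t i ij /=; rewrite delta_neqE // !zeroE.
  rewrite /local_at /=; under eq_fun do rewrite deltaE !zeroE.
  exact: is_deriveC_local_x.
rewrite realizeD fctE !realize_Der /= !subn0 !subn1; ring.
Qed.

Lemma dy_realize j P :
  dy j (realize P) = realize ('i%C *: (act (Der KZ) j P - act (Der KW) j P)).
Proof.
apply: (realize_derive (D := 'i%C \*: (act (Der KZ) j \- act (Der KW) j))) => m w.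
apply: is_deriveC_eq.
  apply: (@is_deriveC_basis _ _ j).
    by move=> t i ij /=; rewrite delta_neqE // !zeroE.
  rewrite /local_at /=; under eq_fun do rewrite deltaE !zeroE.
  exact: is_deriveC_local_y.
rewrite realizeZ realizeB /scale !fctE !realize_Der /= !subn0 !subn1; ring.
Qed.

Lemma dq_realize j P :
  dq j (realize P) = realize (act (Der KU) j P - 2^-1 *: act (Mul KU) j P).
Proof.
apply: (realize_derive (D := act (Der KU) j \- 2^-1 \*: act (Mul KU) j)) => m w.
apply: is_deriveC_eq.
  apply: (@is_deriveC_basis _ _ j).
    by move=> t i ij /=; rewrite delta_neqE // !zeroE.
  rewrite /local_at /=; under eq_fun do rewrite deltaE !zeroE.
  exact: is_deriveC_local_q.
rewrite realizeB realizeZ /scale !fctE realize_Der realize_Mul /=.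
rewrite !subn0 !subn1 !addn0 addn1; ring.
Qed.

Lemma mulz_realize j P : mulz j (realize P) = realize (act (Mul KZ) j P).
Proof.
apply: (realize_mul (D := act (Mul KZ) j)) => m w.
rewrite realize_Mul (basisD1 _ _ j) /local_at /= addn1 !addn0 mulrA.
by congr (_ * _); rewrite /local_basis (exprS (w.1.1 0 j +i* w.1.2 0 j)) !mulrA.
Qed.

Lemma mulzbar_realize j P : mulzbar j (realize P) = realize (act (Mul KW) j P).
Proof.
apply: (realize_mul (D := act (Mul KW) j)) => m w.
rewrite realize_Mul (basisD1 _ _ j) /local_at /= addn1 !addn0 mulrA.
congr (_ * _); rewrite /local_basis (exprS (w.1.1 0 j +i* - w.1.2 0 j)).
by rewrite mulrA [X in X * _ = _]mulrCA.
Qed.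

Lemma mulq_realize j P :
  Defs.mulq j (realize P) = realize (act (Der KU) j P + 2^-1 *: act (Mul KU) j P).
Proof.
apply: (realize_mul (D := act (Der KU) j \+ 2^-1 \*: act (Mul KU) j)) => m w.
rewrite realizeD realizeZ /scale !fctE realize_Der realize_Mul /=.
rewrite (basisD1 _ _ j) /local_at mulrA mulq_local.
rewrite !subn0 !subn1 !addn0 addn1; ring.
Qed.

Lemma zcoordE (w : zspace R n) j :
  zcoord w j = (w.1 0 j)%:C + 'i%C * (w.2 0 j)%:C.
Proof. by rewrite [LHS]complexE. Qed.

Lemma conj_zcoordE (w : zspace R n) j :
  conjc (zcoord w j) = (w.1 0 j)%:C - 'i%C * (w.2 0 j)%:C.
Proof. by rewrite [LHS]complexE /= rmorphN mulrN. Qed.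

Lemma mulii : 'i%C * 'i%C = - 1 :> C.
Proof. by rewrite -expr2 sqr_i. Qed.

Lemma mulx_realize j P :
  mulx j (realize P) = realize (2^-1 *: (act (Mul KZ) j P + act (Mul KW) j P)).
Proof.
rewrite realizeZ realizeD -mulz_realize -mulzbar_realize.
apply/funext => w; rewrite /scale fctE /mulx /mulz /mulzbar.
by rewrite conj_zcoordE zcoordE; field.
Qed.

Lemma muly_realize j P :
  muly j (realize P) =
  realize (('i%C / 2) *: (act (Mul KW) j P - act (Mul KZ) j P)).
Proof.
rewrite realizeZ realizeB -mulz_realize -mulzbar_realize.
apply/funext => w; rewrite /scale !fctE /muly /mulz /mulzbar.
rewrite conj_zcoordE zcoordE; set x := (_)%:C; set y := (_)%:C; set z := realize P w.
transitivity (- ('i%C * 'i%C) * (x * z)); first by rewrite mulii opprK mul1r.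
by field.
Qed.

Lemma act_comm x y j k P : kappa (K := C) x y = 0 ->
  act x j (act y k P) = act y k (act x j P).
Proof. by move=> xy; rewrite fock_ccr xy mulr0 scale0r addr0. Qed.

Notation opA := (quad (@fock_act C n) (Der KU) (Der KZ)).
Notation opB := (quad (@fock_act C n) (Mul KU) (Der KW)).
Notation opD := (quad (@fock_act C n) (Der KZ) (Der KW)).
Notation opAs := (quad (@fock_act C n) (Mul KU) (Mul KZ)).
Notation opBs := (quad (@fock_act C n) (Mul KW) (Der KU)).
Notation opN := (quad (@fock_act C n) (Mul KZ) (Mul KW)).
Notation number v := (quad (@fock_act C n) (Mul v) (Der v)).

Local Arguments fock_act : simpl never.

Lemma quad_fockE x y P :
  quad (@fock_act C n) x y P = \sum_j act x j (act y j P).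
Proof. by []. Qed.

Lemma Ds_realize P : Ds (realize P) = realize (opB P - 2 *: opA P).
Proof.
rewrite !quad_fockE scaler_sumr -sumrB realize_sum; apply: eq_bigr => j _.
rewrite dy_realize mulq_realize -realizeZ dx_realize dq_realize -realizeB.
congr realize; rewrite !fock_actE.
by linear_combination (R[i])
  [:: act (Der KU) j (act (Der KZ) j P); act (Der KU) j (act (Der KW) j P);
      act (Mul KU) j (act (Der KZ) j P); act (Mul KU) j (act (Der KW) j P)];
  field: mulii.
Qed.

Lemma Dt_realize P : Dt (realize P) = realize ('i%C *: (opB P + 2 *: opA P)).
Proof.
rewrite !quad_fockE scaler_sumr -big_split /= scaler_sumr realize_sum.
apply: eq_bigr => j _.
rewrite dx_realize mulq_realize -realizeZ dq_realize dy_realize -realizeD.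
congr realize; rewrite !fock_actE.
rewrite !(@act_comm (Der KZ) _) // !(@act_comm (Der KW) _) //.
by linear_combination (R[i])
  [:: act (Der KU) j (act (Der KZ) j P); act (Der KU) j (act (Der KW) j P);
      act (Mul KU) j (act (Der KZ) j P); act (Mul KU) j (act (Der KW) j P)];
  field: mulii.
Qed.

Lemma Dz_realize P : Dz (realize P) = realize (- 2 *: opA P).
Proof.
rewrite /Dz Ds_realize Dt_realize -realizeZ -realizeD -realizeZ.
congr realize; set x := opA P; set y := opB P.
by linear_combination (R[i]) [:: x; y]; field: mulii.
Qed.

Lemma Dzd_realize P : Dzd (realize P) = realize (opB P).
Proof.
rewrite /Dzd Ds_realize Dt_realize -realizeZ -realizeB -realizeZ.
congr realize; set x := opA P; set y := opB P.
by linear_combination (R[i]) [:: x; y]; field: mulii.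
Qed.

Lemma Xz_realize P : Xz (realize P) = realize ('i%C *: opBs P).
Proof.
rewrite /Xz (_ : \sum_j _ = realize (2 *: opBs P)).
  by rewrite -realizeZ scalerA; congr realize; congr (_ *: _); field.
rewrite !quad_fockE scaler_sumr realize_sum; apply: eq_bigr => j _.
rewrite mulzbar_realize /Lop mulq_realize dq_realize -realizeD; congr realize.
rewrite -(@act_comm (Der KU) (Mul KW)) //.
by linear_combination (R[i]) [:: act (Der KU) j (act (Mul KW) j P);
  act (Mul KU) j (act (Mul KW) j P)]; ring.
Qed.

Lemma Xzd_realize P : Xzd (realize P) = realize (('i%C / 2) *: opAs P).
Proof.
rewrite /Xzd (_ : \sum_j _ = realize (opAs P)) ?realizeZ //.
rewrite !quad_fockE realize_sum; apply: eq_bigr => j _.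
rewrite mulz_realize /Rop mulq_realize dq_realize -realizeB; congr realize.
by linear_combination (R[i]) [:: act (Der KU) j (act (Mul KZ) j P);
  act (Mul KU) j (act (Mul KZ) j P)]; field.
Qed.

Lemma mulnormz2_realize P : mulnormz2 (realize P) = realize (opN P).
Proof.
rewrite !quad_fockE realize_sum; apply/funext => w; rewrite fct_sumE /mulnormz2.
rewrite mulr_suml; apply: eq_bigr => j _.
rewrite -mulz_realize -mulzbar_realize /mulz /mulzbar mulrA; congr (_ * _).
by rewrite normCK.
Qed.

Lemma euler_realize P :
  euler (realize P) = realize (number KZ P + number KW P).
Proof.
rewrite !quad_fockE -big_split /= realize_sum; apply: eq_bigr => j _.
rewrite dx_realize dy_realize mulx_realize muly_realize -realizeD.
congr realize; rewrite !fock_actE.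
by linear_combination (R[i])
  [:: act (Mul KZ) j (act (Der KZ) j P); act (Mul KZ) j (act (Der KW) j P);
      act (Mul KW) j (act (Der KZ) j P); act (Mul KW) j (act (Der KW) j P)];
  field: mulii.
Qed.

Notation raiseW := (raiseW (@fock_act C n)).
Notation raiseZ := (raiseZ (@fock_act C n)).
Notation embedding := (embedding (@fock_act C n)).

(** The Euler operator is the sum of the degrees in z and w, so that the constants
    of [XXz] are the degree factor of [raiseW]. *)
Lemma XXz_realize P : XXz (realize P) = realize ('i%C *: raiseW P).
Proof.
rewrite /XXz Xz_realize euler_realize Dz_realize mulnormz2_realize.
rewrite -!realizeZ -!realizeD; congr realize; rewrite /raiseW !quadZ.
by linear_combination (R[i])
  [:: number KZ (opBs P); number KW (opBs P); opBs P; opN (opA P)]; field.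
Qed.

Lemma XXzd_realize P : XXzd (realize P) = realize (('i%C / 2) *: raiseZ P).
Proof.
rewrite /XXzd Xzd_realize euler_realize Dzd_realize mulnormz2_realize.
rewrite -!realizeZ -!realizeD -realizeB; congr realize; rewrite /raiseZ !quadZ.
by linear_combination (R[i])
  [:: number KZ (opAs P); number KW (opAs P); opAs P; opN (opB P)]; field.
Qed.

Lemma embed_realize k l P :
  embed k l (realize P) = realize (('i%C ^+ k * ('i%C / 2) ^+ l) *: embedding k l P).
Proof.
rewrite /embed /embedding.
have -> : iter l XXzd (realize P) = realize (('i%C / 2) ^+ l *: iter l raiseZ P).
  elim: l => [|l IHl]; first by rewrite expr0 scale1r.
  by rewrite iterS IHl XXzd_realize raiseZZ scalerA -exprS.
elim: k => [|k IHk]; first by rewrite mul1r.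
by rewrite iterS IHk XXz_realize raiseWZ scalerA mulrA -exprS.
Qed.

End Realization.

(** * Spans *)

Section Spans.
Context {R : realType} {T : Type}.
Implicit Types (A : set (T -> R[i])) (f g : T -> R[i]).

Lemma lin_span_ind A (S : (T -> R[i]) -> Prop) f :
    S 0 -> (forall c g h, S g -> S h -> S (fun t => c * g t + h t)) ->
    A `<=` S -> lin_span A f -> S f.
Proof.
move=> S0 SD AS [m [c [g [Ag ->]]]]; elim: m c g Ag => [|m IHm] c g Ag.
  by under eq_fun do rewrite big_ord0.
under eq_fun do rewrite big_ord_recl.
by apply: SD; [apply: AS|apply: (IHm (c \o lift ord0) (g \o lift ord0)) => k /=].
Qed.

Lemma sub_lin_span A : A `<=` lin_span A.
Proof.
move=> f Af; exists 1%N, (fun=> 1), (fun=> f); split=> //.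
by apply/funext => t; rewrite big_ord1 mul1r.
Qed.

Lemma lin_span0 A : lin_span A 0.
Proof.
exists 0%N, (fun=> 0), (fun=> 0); split=> [[]//|].
by apply/funext => t; rewrite big_ord0.
Qed.

Lemma lin_spanP A c f g : lin_span A f -> lin_span A g ->
  lin_span A (fun t => c * f t + g t).
Proof.
move=> [k [d [F [AF ->]]]] [l [e [G [AG ->]]]].
exists (k + l)%N.
exists (fun i => match fintype.split i with inl j => c * d j | inr j => e j end).
exists (fun i => match fintype.split i with inl j => F j | inr j => G j end).
split=> [i|]; first by case: (fintype.split i).
apply/funext => t; rewrite big_split_ord mulr_sumr; congr (_ + _).
  by apply: eq_bigr => j _; rewrite (unsplitK (inl j)) mulrA.
by apply: eq_bigr => j _; rewrite (unsplitK (inr j)).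
Qed.

End Spans.

(** * Polynomials and tensor products in the Fock model *)

Section Transfer.
Context {R : realType} {n : nat}.
Notation C := R[i].
Implicit Types (P Q : fock n C) (m : monom (n + n + n)).
Notation act := (@fock_act C n).
Notation fweight := (weight act).
Notation opD := (quad act (Der KZ) (Der KW)).

Local Arguments var : simpl never.

Definition zmonomial m (z : zspace R n) : C :=
  \prod_j (zcoord z j ^+ m (var KZ j) * conjc (zcoord z j) ^+ m (var KW j)).

Lemma basis_hermite m (w : zqspace R n) :
  basis m w = zmonomial m w.1 * hermite_function (fun j => m (var KU j)) w.2.
Proof.
rewrite /hermite_function -sumrN mulr_suml expR_sum -big_split /=.
rewrite (rmorph_prod (real_complex R)) -big_split; by apply: eq_bigr => j _.
Qed.

Lemma hermite_function0 : hermite_function (fun=> 0%N) (0 : 'rV[R]_n) = 1.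
Proof.
rewrite /hermite_function big1 => [|j _]; last by rewrite mxE expr0n.
rewrite oppr0 mul0r expR0 mul1r big1 // => j _; by rewrite hornerC.
Qed.

Lemma mon_degree0 v m : mon_degree v m = 0%N -> forall j, m (var v j) = 0%N.
Proof. by move=> /eqP; rewrite sum_nat_eq0 => /forallP h j; apply/eqP/(h j). Qed.

Lemma basis_at0 m (z : zspace R n) : mon_degree KU m = 0%N ->
  basis m (z, 0) = zmonomial m z.
Proof.
move=> /mon_degree0 m0; rewrite basis_hermite /=.
have -> : (fun j => m (var KU j)) = (fun=> 0%N) by apply/funext => j; apply: m0.
by rewrite hermite_function0 mulr1.
Qed.

(** At q = 0 the Gaussian is one: the value there is the polynomial in z that is the
    coefficient of the Hermite function. *)
Lemma realize_umonom P g z q :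
    (forall m, m \in mpoly.msupp P -> mon_degree KU m = 0%N) ->
  realize (P * 'Xm_[umonom g]) (z, q) = realize P (z, 0) * hermite_function g q.
Proof.
move=> P0; rewrite {1}[P]mpoly.mpolyE mulr_suml realize_sum fct_sumE.
rewrite [in RHS]/realize mulr_suml [LHS]big_seq [RHS]big_seq.
apply: eq_bigr => m mP; rewrite -scalerAl -mpoly.mpolyXD realizeZ realize_monomial.
rewrite /scale -mulrA basis_at0 ?P0 // basis_hermite /=; congr (_ * (_ * _)).
  by apply: eq_bigr => j _; rewrite !mpoly.mnmDE !umonomE !addn0.
congr hermite_function; apply/funext => j.
by rewrite mpoly.mnmDE umonomE (mon_degree0 (P0 m mP)).
Qed.

Lemma realize_act_eq0 v j P : realize P = 0 -> realize (act (Der v) j P) = 0.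
Proof.
move=> P0; have d0 (F : zqspace R n) : deriveC F (0 : zqspace R n -> C) = 0.
  apply/funext => w; apply: deriveC_line; exact: is_deriveC_cst.
have dzw : realize (act (Der KZ) j P + act (Der KW) j P) = 0.
  by rewrite -dx_realize P0; exact: d0.
have idzw : realize ('i%C *: (act (Der KZ) j P - act (Der KW) j P)) = 0.
  by rewrite -dy_realize P0; exact: d0.
have qu : realize (act (Der KU) j P + 2^-1 *: act (Mul KU) j P) = 0.
  by rewrite -mulq_realize P0; apply/funext => w; exact: mulr0.
have du : realize (act (Der KU) j P - 2^-1 *: act (Mul KU) j P) = 0.
  by rewrite -dq_realize P0; exact: d0.
have half (Q Q' : fock n C) (c d : C) :
    realize Q = 0 -> realize Q' = 0 -> realize (c *: Q + d *: Q') = 0.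
  move=> h h'; rewrite realizeD !realizeZ h h'; apply/funext => w.
  by rewrite /scale !fctE !mulr0 addr0.
case: v.
- rewrite -(half _ _ 2^-1 (- 'i%C / 2) dzw idzw); congr realize.
  by linear_combination (R[i]) [:: act (Der KZ) j P; act (Der KW) j P];
    field: (@mulii R).
- rewrite -(half _ _ 2^-1 ('i%C / 2) dzw idzw); congr realize.
  by linear_combination (R[i]) [:: act (Der KZ) j P; act (Der KW) j P];
    field: (@mulii R).
rewrite -(half _ _ 2^-1 2^-1 qu du); congr realize.
by linear_combination (R[i]) [:: act (Der KU) j P; act (Mul KU) j P]; field.
Qed.

(** [realize] intertwines the derivatives in z, w and u with operators on functions,
    so its kernel is stable under them. By induction on the degree, the derivatives
    of a polynomial in the kernel vanish, which makes it constant, and a constant is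
    sent to a multiple of the Gaussian. *)
Lemma realize_inj P : realize P = 0 -> P = 0.
Proof.
have [d] : exists d, forall m, (d <= mpoly.mdeg m)%N -> mpoly.mcoeff m P = 0.
  exists (mpoly.mmeasure mpoly.mdeg P) => m /mpoly.msize_mdeg_ge.
  exact: mpoly.memN_msupp_eq0.
elim: d P => [|d IHd] P Pd P0.
  by apply/mpoly.mpolyP => m; rewrite Pd ?mpoly.mcoeff0.
have Pm m i : m i != 0%N -> mpoly.mcoeff m P = 0.
  have [v [j ->]] := var_cases i; move=> mi.
  have : act (Der v) j P = 0.
    apply: IHd (realize_act_eq0 v j P0) => m' dm.
    rewrite /= mpoly.mcoeff_deriv Pd ?mul0rn //.
    by rewrite mpoly.mdegD mpoly.mdeg1 addn1.
  move=> /(congr1 (mpoly.mcoeff (mpoly.mnm_sub m (mpoly.mnm1 (var v j))))).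
  rewrite /= mpoly.mcoeff_deriv mpoly.submK ?mpoly.lep1mP // mpoly.mcoeff0.
  by move=> /eqP; rewrite -mulr_natr mulf_eq0 pnatr_eq0 orbF => /eqP.
have PC : P = mpoly.mcoeff mpoly.mnm0 P *: 'Xm_[mpoly.mnm0].
  apply/mpoly.mpolyP => m; rewrite mpoly.mcoeffZ mpoly.mcoeffX.
  have [<-|m0] := eqVneq mpoly.mnm0 m; first by rewrite mulr1.
  rewrite mulr0; have /existsP[i mi] : [exists i, m i != 0%N].
    apply: contraNT m0; rewrite negb_exists => /forallP h.
    apply/eqP/mpoly.mnmP => i; rewrite mpoly.mnm0E; apply/esym/eqP.
    by have := h i; rewrite negbK.
  exact: Pm mi.
move: P0; rewrite PC realizeZ realize_monomial => /(congr1 (fun F => F (0, 0))).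
have u0 : (fun j => (mpoly.mnm0 : monom (n + n + n)) (var KU j)) = (fun=> 0%N).
  by apply/funext => j; rewrite mpoly.mnm0E.
rewrite /scale basis_hermite u0 hermite_function0 mulr1 /zmonomial.
rewrite big1 ?mulr1; last first.
  by move=> j _; rewrite !mpoly.mnm0E mulr1.
by rewrite -[(0 : zqspace R n -> C) _]/(0 : C) => ->; rewrite scale0r.
Qed.

Notation number v := (quad act (Mul v) (Der v)).

Lemma ufree P m : number KU P = 0 -> m \in mpoly.msupp P ->
  mon_degree KU m = 0%N.
Proof.
move=> P0 mP; apply/eqP; rewrite -(eqr_nat C) eq_sym; apply/eqP.
by apply: fock_eigenvalue mP; rewrite P0 scale0r.
Qed.

Lemma ufree_eq0 P : number KU P = 0 -> (forall z, realize P (z, 0) = 0) -> P = 0.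
Proof.
move=> uP P0; apply: realize_inj; apply/funext => -[z q].
have u0 : umonom (fun=> 0%N) = mpoly.mnm0 :> monom (n + n + n).
  apply/mpoly.mnmP => i; have [v [j ->]] := var_cases i.
  by rewrite umonomE mpoly.mnm0E; case: v.
have := @realize_umonom P (fun=> 0%N) z q (fun m => ufree uP).
by rewrite u0 mpoly.mpolyX0 mulr1 P0 mul0r.
Qed.

(** ** Bihomogeneous polynomials *)

Definition zw_part m : monom (n + n) :=
  mpoly.Multinom [tuple m (lshift n i) | i < n + n].

Definition zw_embed (m : monom (n + n)) : monom (n + n + n) :=
  mpoly.Multinom [tuple if fintype.split i is inl k then m k else 0%N
    | i < n + n + n].

Lemma zw_embedK : cancel zw_embed zw_part.
Proof.
move=> m; apply/mpoly.mnmP => i; rewrite !mpoly.mnmE.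
by rewrite (unsplitK (inl i)).
Qed.

Lemma mon_degree_zw_embed (m : monom (n + n)) : mon_degree KU (zw_embed m) = 0%N.
Proof.
by apply: big1 => j _; rewrite mpoly.mnmE (unsplitK (inr j)).
Qed.

Lemma meval_zzbar m (u v : 'rV[C]_n) :
  mpoly.meval (zzbar u v) 'Xm_[zw_part m] =
  \prod_j (u 0 j ^+ m (var KZ j) * v 0 j ^+ m (var KW j)).
Proof.
rewrite mpoly.mevalX big_split_ord big_split; congr (_ * _);
  apply: eq_bigr => j _; rewrite mpoly.mnmE /zzbar ?row_mxEl ?row_mxEr //.
Qed.

Lemma meval_zmonomial m (z : zspace R n) (u := \row_j zcoord z j) :
  mpoly.meval (zzbar u (map_mx conjc u)) 'Xm_[zw_part m] = zmonomial m z.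
Proof. by rewrite meval_zzbar; apply: eq_bigr => j _; rewrite !mxE. Qed.

Lemma meval_dilation m (lam : C) (u : 'rV[C]_n) :
  mpoly.meval (zzbar (lam *: u) (conjc lam *: map_mx conjc u)) 'Xm_[zw_part m] =
  lam ^+ mon_degree KZ m * conjc lam ^+ mon_degree KW m *
  mpoly.meval (zzbar u (map_mx conjc u)) 'Xm_[zw_part m].
Proof.
rewrite !meval_zzbar -!prodrXr -!big_split; apply: eq_bigr => j _ /=.
by rewrite !mxE !exprMn mulrACA.
Qed.

Lemma realize_at0 P z : number KU P = 0 ->
  realize P (z, 0) = \sum_(m <- mpoly.msupp P) mpoly.mcoeff m P * zmonomial m z.
Proof.
move=> uP; rewrite /realize /linear_ext big_seq [RHS]big_seq.
by apply: eq_bigr => m mP; rewrite basis_at0 ?(ufree uP).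
Qed.

(** A polynomial in z alone is recovered from the function it represents on the
    slice q = 0; this makes the results on [realize] available for functions of z. *)
Definition restrict0 (F : zqspace R n -> C) : zspace R n -> C := fun z => F (z, 0).

Lemma polys_realize (a b : nat) P : fweight a%:R b%:R 0 P ->
  polys a b (restrict0 (realize P)).
Proof.
move=> wP; have wm m := weight_msupp (r := 0) wP (m := m).
exists (\sum_(m <- mpoly.msupp P) mpoly.mcoeff m P *: 'Xm_[zw_part m]).
  move=> lam z; rewrite !raddf_sum mulr_sumr big_seq [RHS]big_seq.
  apply: eq_bigr => m /wm[<- <- _] /=; rewrite !mpoly.mevalZ meval_dilation.
  by rewrite mulrCA.
apply/funext => z; rewrite /restrict0 realize_at0; last first.
  by case: wP => _ _ ->; rewrite scale0r.
rewrite raddf_sum; apply: eq_bigr => m _ /=.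
by rewrite mpoly.mevalZ meval_zmonomial.
Qed.

(** Taking [lam = 2] compares the total degrees. If the bidegrees differed, a root
    [lam] of -1 of order twice the difference, which has modulus one, would give
    1 = -1. *)
Lemma bidegree_inj (a b c d : nat) :
    (forall lam : C, lam ^+ a * conjc lam ^+ b = lam ^+ c * conjc lam ^+ d) ->
  a = c /\ b = d.
Proof.
move=> h; have abcd : (a + b = c + d)%N.
  have := h 2; have -> : conjc (2 : C) = 2 by rewrite (rmorph_nat (@conjc R)).
  rewrite -!exprD -!natrX => /eqP; rewrite eqr_nat eqn_exp2l // => /eqP.
  by [].
have root e : (0 < e)%N -> exists2 lam : C, lam ^+ (e + e) = -1 &
    lam * conjc lam = 1.
  move=> e0; have e2 : (0 < e + e)%N by rewrite addn_gt0 e0.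
  exists ((e + e).-root%C (-1)); first by rewrite rootCK.
  rewrite -[conjc _]/((_)^*) -normCK.
  suff -> : `|(e + e).-root%C (-1 : C)| = 1 by rewrite expr1n.
  apply/eqP; rewrite -(@pexpr_eq1 _ _ (e + e)) // -normrX rootCK //.
  by rewrite normrN1.
have half (a' b' c' d' : nat) : (a' + b' = c' + d')%N -> (c' < a')%N ->
    (forall lam : C, lam ^+ a' * conjc lam ^+ b' = lam ^+ c' * conjc lam ^+ d') ->
    False.
  move=> s lt h'; have [|lam lame lam1] := root (a' - c')%N; first by rewrite subn_gt0.
  have lam0 : lam != 0.
    by apply/eqP => l0; move: lam1; rewrite l0 mul0r => /esym/eqP; rewrite oner_eq0.
  have lc0 : conjc lam != 0.
    by apply/eqP => l0; move: lam1; rewrite l0 mulr0 => /esym/eqP; rewrite oner_eq0.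
  have cE : conjc lam = lam^-1 by apply: (mulfI lam0); rewrite lam1 divff.
  have := h' lam; have -> : d' = (b' + (a' - c'))%N by lia.
  rewrite -{1}(subnK (ltnW lt)) !exprD; set x := lam ^+ _; set y := _ ^+ (a' - c').
  set u := lam ^+ c'; set v := _ ^+ b' => eq.
  have uv0 : u * v != 0 by rewrite mulf_neq0 // expf_neq0.
  have xy : x = y by apply: (mulfI uv0); rewrite -[RHS]mulrA -eq; ring.
  have : x * y = 1 by rewrite -exprMn lam1 expr1n.
  rewrite -xy -exprD lame => /eqP; rewrite eq_sym -addr_eq0 -(natrD _ 1 1).
  by rewrite pnatr_eq0.
have [ac|ca|//] := ltngtP a c.
- by case: (half c d a b).
- by case: (half a b c d).
by move=> ac; split=> //; move: abcd; rewrite ac => /addnI.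
Qed.

Lemma meval_msupp (N : nat) (v : 'I_N -> C) (P : mpoly.mpoly N C) :
  mpoly.meval v P =
  \sum_(m <- mpoly.msupp P) mpoly.mcoeff m P * mpoly.meval v 'Xm_[m].
Proof.
rewrite {1}[P]mpoly.mpolyE raddf_sum.
by apply: eq_bigr => m _; rewrite /= mpoly.mevalZ.
Qed.

(** Bihomogeneity is a condition on values; since polynomials in z and w are
    determined by their values at w = conj(z), it holds coefficient by coefficient,
    and then [bidegree_inj] gives the degrees of each monomial. *)
Lemma polys_in_realize (a b : nat) p : polys a b p ->
  exists2 P, fweight a%:R b%:R 0 P & p = restrict0 (realize P).
Proof.
move=> [P bihom ->].
pose lift (c : monom (n + n) -> C) : fock n C :=
  \sum_(m <- mpoly.msupp P) c m *: 'Xm_[zw_embed m].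
have lift_ufree c : number KU (lift c) = 0.
  rewrite quad_sum big1 // => m _.
  by rewrite quadZ number_monomial mon_degree_zw_embed scale0r scaler0.
have realize_lift c z : realize (lift c) (z, 0) =
    \sum_(m <- mpoly.msupp P) c m * zmonomial (zw_embed m) z.
  rewrite realize_sum fct_sumE; apply: eq_bigr => m _.
  by rewrite realizeZ realize_monomial /scale basis_at0 ?mon_degree_zw_embed.
have mcoeff_lift c (m : monom (n + n)) : m \in mpoly.msupp P ->
    mpoly.mcoeff (zw_embed m) (lift c) = c m.
  move=> mP; rewrite raddf_sum (bigD1_seq m) ?mpoly.msupp_uniq //=.
  rewrite mpoly.mcoeffZ mpoly.mcoeffX eqxx mulr1 big1 ?addr0 // => m' ne.
  rewrite mpoly.mcoeffZ mpoly.mcoeffX (can_eq zw_embedK).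
  by rewrite (negPf ne) mulr0.
pose deg v (m : monom (n + n)) := mon_degree v (zw_embed m).
have degE (m : monom (n + n)) : m \in mpoly.msupp P -> deg KZ m = a /\ deg KW m = b.
  move=> mP; apply: bidegree_inj => lam; apply/eqP; rewrite -subr_eq0.
  pose c (m : monom (n + n)) :=
    mpoly.mcoeff m P * (lam ^+ deg KZ m * conjc lam ^+ deg KW m
    - lam ^+ a * conjc lam ^+ b).
  (* [lift c] represents the difference of the two sides of the bihomogeneity
     condition for [lam]. *)
  have c0 : lift c = 0.
    apply: ufree_eq0 => // z; rewrite realize_lift.
    have := bihom lam (\row_j zcoord z j).
    rewrite !(meval_msupp _ P) mulr_sumr => /eqP.
    rewrite -subr_eq0 -sumrB => /eqP h; rewrite -[RHS]h; apply: eq_bigr => m' _.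
    rewrite -{4 6}(zw_embedK m') meval_dilation.
    by rewrite meval_zmonomial /c; ring.
  have := mcoeff_lift c m mP; rewrite c0 mpoly.mcoeff0 => /esym/eqP.
  by rewrite mulf_eq0 mpoly.mcoeff_eq0 mP.
exists (lift (fun m : monom (n + n) => mpoly.mcoeff m P)).
  rewrite /lift big_seq; apply: weight_sum => m /degE[<- <-]; apply: weightZ.
  rewrite -[0]/(0%:R) -(mon_degree_zw_embed m); exact: weight_monomial.
apply/funext => z; rewrite /restrict0 realize_lift meval_msupp.
by apply: eq_bigr => m _; rewrite -meval_zmonomial zw_embedK.
Qed.

(** ** Harmonic polynomials and monogenics *)

Lemma deriveC_restrict0 (v : zspace R n) (F : zqspace R n -> C) :
  deriveC v (restrict0 F) = restrict0 (deriveC ((v, 0) : zqspace R n) F).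
Proof.
have dE (h : zqspace R n -> R) (z : zspace R n) :
    'D_v (fun u => h (u, 0)) z = 'D_((v, 0) : zqspace R n) h (z, 0).
  apply: (f_equal (fun G : R -> R => lim (G @ 0^'))).
  apply/funext => s /=; congr (_ *: (h _ - _)).
  by rewrite -[RHS]/(_, _) /= scaler0 addr0.
apply/funext => z; rewrite /deriveC /restrict0.
by rewrite (dE (fun u => complex.Re (F u))) (dE (fun u => complex.Im (F u))).
Qed.

Lemma laplacian_realize P :
  laplacian (restrict0 (realize P)) = restrict0 (realize (4 *: opD P)).
Proof.
rewrite quad_fockE scaler_sumr realize_sum; apply/funext => z.
rewrite /laplacian /restrict0 !fct_sumE; apply: eq_bigr => j _.
rewrite !deriveC_restrict0 -!/(dx j _) -!/(dy j _).
rewrite !dx_realize !dy_realize -[LHS]/((realize _ + realize _) (z, 0)).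
rewrite -realizeD; congr (realize _ _); rewrite !fock_actE.
rewrite (@act_comm R n (Der KW) (Der KZ)) //.
by linear_combination (R[i])
  [:: fock_act (Der KZ) j (fock_act (Der KZ) j P);
      fock_act (Der KZ) j (fock_act (Der KW) j P);
      fock_act (Der KW) j (fock_act (Der KW) j P)]; field: (@mulii R).
Qed.

Notation HW := (harmonic_weight act).

Lemma harmonics_realize (a b : nat) P : HW a%:R b%:R 0 P ->
  harmonics a b (restrict0 (realize P)).
Proof.
move=> [wP hP]; split; first exact: polys_realize.
by rewrite /= laplacian_realize hP scaler0 realize0.
Qed.

Lemma harmonics_in_realize (a b : nat) p : harmonics a b p ->
  exists2 P, HW a%:R b%:R 0 P & p = restrict0 (realize P).
Proof.
move=> [/polys_in_realize[P wP ->] /= lap0]; exists P => //; split=> //.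
have [_ _ uDP] := weight_D fock_ccr wP.
have : 4 *: opD P = 0.
  apply: ufree_eq0 => [|z]; first by rewrite quadZ uDP scale0r scaler0.
  by rewrite -[LHS]/(restrict0 _ z) -laplacian_realize lap0.
by move=> /eqP; rewrite scaler_eq0 pnatr_eq0 => /eqP.
Qed.

Lemma mon_degreeD v m m' :
  mon_degree v (mpoly.mnm_add m m') = (mon_degree v m + mon_degree v m')%N.
Proof. by rewrite -big_split; apply: eq_bigr => j _; rewrite mpoly.mnmDE. Qed.

Lemma weight_umonom (a b : nat) P g : fweight a%:R b%:R 0 P ->
  fweight a%:R b%:R (\sum_j g j)%:R (P * 'Xm_[umonom g]).
Proof.
move=> wP; have wm m := weight_msupp (r := 0) wP (m := m).
rewrite [P]mpoly.mpolyE mulr_suml [X in weight _ _ _ _ X]big_seq.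
apply: weight_sum => m /wm[<- <- m0].
rewrite -scalerAl -mpoly.mpolyXD; apply: weightZ.
have dg v : mon_degree v (umonom g) = if v is KU then (\sum_j g j)%N else 0%N.
  by case: v; rewrite /mon_degree; under eq_bigr do rewrite umonomE;
    rewrite // sum_nat_const muln0.
have := @weight_monomial C n (mpoly.mnm_add m (umonom g)).
by rewrite !mon_degreeD !dg m0 !addn0.
Qed.

Lemma opD_umonom P g : opD (P * 'Xm_[umonom g]) = opD P * 'Xm_[umonom g].
Proof.
have d0 v j : v <> KU -> mpoly.mderiv (var v j) 'Xm_[umonom g] = 0 :> fock n C.
  by move=> vU; rewrite mpoly.mderivX umonomE; case: v vU; rewrite ?scale0r.
rewrite !quad_fockE mulr_suml; apply: eq_bigr => j _.
rewrite /fock_act mpoly.mderivM (d0 KW) // mulr0 addr0.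
by rewrite mpoly.mderivM (d0 KZ) // mulr0 addr0.
Qed.

(** The property [S] stands for being harmonic or for no condition, so that both
    kinds of tensor products are covered. *)
Lemma tensor_in_realize (U : set (zspace R n -> C)) (S : fock n C -> Prop)
    (a b r : nat) F :
    S 0 -> (forall c P Q, S P -> S Q -> S (c *: P + Q)) ->
    (forall P g, S P -> S (P * 'Xm_[umonom g])) ->
    (forall p, U p -> exists P,
       [/\ fweight a%:R b%:R 0 P, S P & p = restrict0 (realize P)]) ->
    tensor U (spinors r) F ->
  exists Q, [/\ fweight a%:R b%:R r%:R Q, S Q & F = realize Q].
Proof.
move=> S0 SD SX US.
pose T F := exists Q, [/\ fweight a%:R b%:R r%:R Q, S Q & F = realize Q].
have T0 : T 0 by exists 0; rewrite realize0; split=> //; exact: weight0.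
have TD c G H : T G -> T H -> T (fun t => c * G t + H t).
  move=> [P [wP SP ->]] [Q [wQ SQ ->]]; exists (c *: P + Q).
  split; [by apply/weightD => //; apply: weightZ|exact: SD|].
  by rewrite realizeP.
apply: (lin_span_ind T0 TD) => _ [p [phi [Up sphi ->]]].
have [P [wP SP pE]] := US p Up.
apply: (lin_span_ind (S := fun phi => T (fun w => p w.1 * phi w.2)) _ _ _ sphi).
- rewrite (_ : (fun w => _) = 0) //; apply/funext => w; exact: mulr0.
- move=> c g h Tg Th; have := TD c _ _ Tg Th; congr T.
  by apply/funext => w; rewrite mulrDr mulrCA.
move=> _ [g gr ->]; exists (P * 'Xm_[umonom g]); split; last 1 first.
- apply/funext => -[z q]; rewrite realize_umonom ?pE // => m mP.
  by apply: ufree mP; case: wP => _ _ ->; rewrite scale0r.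
- by rewrite -gr; apply: weight_umonom.
exact: SX.
Qed.

(** Derivatives in u commute with the Laplacian, so the coefficients of the Hermite
    functions in a harmonic [Q] are harmonic. *)
Lemma tensor_harmonics_realize (a b r : nat) Q : HW a%:R b%:R r%:R Q ->
  tensor (harmonics a b) (spinors r) (realize Q).
Proof.
move=> [wQ hQ].
apply: (fock_euler_ind (S := fun P => opD P = 0)
  (C := fun P => tensor (harmonics a b) (spinors r) (realize P)) _ _ _ _ wQ hQ).
- move=> j P hP; have := act_quad fock_ccr (Der KU) (Der KZ) (Der KW) j P.
  by rewrite hP raddf0 /kappa /= !scale0r !addr0 => <-.
- by rewrite realize0; exact: lin_span0.
- by move=> c P P' tP tP'; rewrite realizeP; apply: lin_spanP.
move=> P g wP hP gr; apply: sub_lin_span.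
exists (restrict0 (realize P)), (hermite_function g); split.
- exact: harmonics_realize.
- by apply: sub_lin_span; exists g.
apply/funext => -[z q]; rewrite realize_umonom // => m mP.
by apply: ufree mP; case: wP => _ _ ->; rewrite scale0r.
Qed.

Lemma tensor_harmonics_in_realize (a b r : nat) F :
    tensor (harmonics a b) (spinors r) F ->
  exists2 Q, HW a%:R b%:R r%:R Q & F = realize Q.
Proof.
move=> tF; have [|||p|Q [wQ hQ ->]] :=
    @tensor_in_realize (harmonics a b) (fun P => opD P = 0) a b r F _ _ _ _ tF.
- by rewrite quad0.
- by move=> c P Q hP hQ; rewrite quadD quadZ hP hQ scaler0 addr0.
- by move=> P g hP; rewrite opD_umonom hP mul0r.
- by move=> /harmonics_in_realize[P [wP hP] ->]; exists P.
by exists Q.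
Qed.

(** A monogenic is harmonic, so it is enough to expand it with harmonic
    coefficients. *)
Lemma monogenic_realize (c d s : nat) Q : monogenic act c%:R d%:R s%:R Q ->
  h_monogenics c d s (realize Q).
Proof.
move=> mQ; have [wQ AQ BQ] := mQ; split; last first.
  by rewrite /= Ds_realize Dt_realize AQ BQ scaler0 subr0 addr0 scaler0 realize0.
have := tensor_harmonics_realize (monogenic_harmonic fock_ccr mQ).
apply: lin_span_ind; [exact: lin_span0|by move=> *; apply: lin_spanP|].
move=> _ [p [phi [[Up _] sphi ->]]]; apply: sub_lin_span.
by exists p, phi.
Qed.

Lemma monogenic_in_realize (c d s : nat) F : h_monogenics c d s F ->
  exists2 Q, monogenic act c%:R d%:R s%:R Q & F = realize Q.
Proof.
move=> [tF /= [DsF DtF]]; have [|||p|Q [wQ _ FE]] :=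
    @tensor_in_realize (polys c d) (fun=> True) c d s F _ _ _ _ tF => //.
  by move=> /polys_in_realize[P wP ->]; exists P.
exists Q => //; rewrite FE Ds_realize in DsF; rewrite FE Dt_realize in DtF.
have e1 := realize_inj DsF; have e2 := realize_inj DtF.
have {}e2 : quad act (Mul KU) (Der KW) Q + 2 *: quad act (Der KU) (Der KZ) Q = 0.
  have := congr1 (fun P => - 'i%C *: P) e2; rewrite scaler0 scalerA mulNr mulii.
  by rewrite opprK scale1r.
split=> //.
  have := congr1 (fun P => 4^-1 *: P) e2; rewrite scaler0 => <-.
  rewrite -[X in _ = X]subr0 -[X in _ = _ - X](scaler0 _ 4^-1) -e1.
  set x := quad _ _ _ _; set y := quad _ _ _ _.
  by linear_combination (R[i]) [:: x; y]; field.
have := congr1 (fun P => 2^-1 *: P) e2; rewrite scaler0 => <-.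
rewrite -[X in _ = X]addr0 -[X in _ = _ + X](scaler0 _ 2^-1) -e1.
set x := quad _ _ _ _; set y := quad _ _ _ _.
by linear_combination (R[i]) [:: x; y]; field.
Qed.

End Transfer.

(** * The decomposition *)

Section Decomposition.
Context {R : realType} {n : nat}.
Notation C := R[i].
Notation act := (@fock_act C n).
Notation embedding := (embedding act).

Definition embed_scalar (k l : nat) : C := 'i%C ^+ k * ('i%C / 2) ^+ l.

Lemma embed_scalar_neq0 k l : embed_scalar k l != 0.
Proof.
have i0 : 'i%C != 0 :> C by rewrite eq_complex /= oner_eq0 andbF.
by rewrite mulf_neq0 ?expf_neq0 // mulf_neq0 // invr_eq0 pnatr_eq0.
Qed.

(** The scalar relating [embed] to [embedding] is invertible, hence absorbed by the
    space of monogenics. *)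
Lemma embed_image (k l c d s : nat) G :
    (@embed R n k l @` h_monogenics c d s) G <->
  exists2 Q, monogenic act c%:R d%:R s%:R Q & G = realize (embedding k l Q).
Proof.
split=> [[_ /monogenic_in_realize[Q mQ ->] <-]|[Q mQ ->]].
  exists (embed_scalar k l *: Q); first exact: monogenicZ.
  by rewrite embed_realize (embeddingZ act).
exists (realize ((embed_scalar k l)^-1 *: Q)).
  exact/monogenic_realize/monogenicZ.
rewrite embed_realize (embeddingZ act) scalerA divff ?scale1r //.
exact: embed_scalar_neq0.
Qed.

End Decomposition.

Theorem theorem6p15 (R : realType) (n : nat) (hn : (3 <= n)%N) (a b r : nat) :
  internal_direct_sum
    (fun ji : 'I_a.+1 * 'I_b.+1 => (ji.2 + ji.1 <= r)%N)
    (fun ji : 'I_a.+1 * 'I_b.+1 =>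
       @embed R n (b - ji.2) ji.1 @`
         h_monogenics (a - ji.1) ji.2 (b + r - (ji.2 + ji.1)))
    (tensor (@harmonics R n a b) (spinors r)).
Proof.
have ccr := @fock_ccr R[i] n; have num := @fock_number_nat R[i] n.
have n_gt1 : (1 < n)%N by apply: ltnW.
split.
- move=> [l i] /= lir G /embed_image[Q mQ ->].
  apply: tensor_harmonics_realize.
  have ha : (l <= a)%N by rewrite -ltnS.
  have hb : (i <= b)%N by rewrite -ltnS.
  apply: harmonic_eq (harmonic_embedding ccr _ _ (monogenic_harmonic ccr mQ)).
  + by rewrite -natrD subnK.
  + by rewrite -natrD subnKC.
  + by rewrite -natrD -natrB; [congr _%:R; lia|lia].
- move=> F /tensor_harmonics_in_realize[Q hQ ->].
  have [m [mono ->]] := harmonic_span ccr num n_gt1 hQ.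
  exists (fun p : 'I_a.+1 * 'I_b.+1 =>
    realize (embedding (@fock_act R[i] n) (b - p.2) p.1 (m p))).
  split; last by rewrite realize_sum.
  by move=> p lir; apply/embed_image; exists (m p) => //; apply: mono.
move=> g gW sum0.
have /choice[m mE] : forall p : 'I_a.+1 * 'I_b.+1, exists Q, (p.2 + p.1 <= r)%N ->
    monogenic (@fock_act R[i] n) (a - p.1)%:R p.2%:R (b + r - (p.2 + p.1))%:R Q /\
    g p = realize (embedding (@fock_act R[i] n) (b - p.2) p.1 Q).
  move=> p; case: (boolP (p.2 + p.1 <= r)%N) => [lir|]; last by exists 0.
  by have /embed_image[Q mQ gE] := gW p lir; exists Q.
have emb0 : \sum_(p : 'I_a.+1 * 'I_b.+1 | (p.2 + p.1 <= r)%N)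
    embedding (@fock_act R[i] n) (b - p.2) p.1 (m p) = 0.
  apply: realize_inj; rewrite realize_sum -[RHS]sum0.
  by apply: eq_bigr => p /mE[_ ->].
move=> p lir; have [_ ->] := mE p lir.
rewrite (embedding_independent ccr n_gt1 (fun q h => (mE q h).1) emb0 lir).
exact: realize0.
Qed.
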